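(* Let $\nu:=\mathcal{G}_\#\mu$ be a probability measure on $L^2(U)$ with finite second moment. Consider reconstructions $\mathcal{R}:\mathbb{R}^p\to L^2(U)$ of the affine form $\mathcal{R}(\alpha_1,\dots,\alpha_p)=\tau_0+\sum_{j=1}^p\alpha_j\tau_j$ with $\tau_0,\dots,\tau_p\in L^2(U)$. Then the reconstruction error $$\left(\int_{L^2(U)}\|\mathcal{R}\circ\mathcal{P}(v)-v\|_{L^2(U)}^2\,d\nu(v)\right)^{1/2},$$ in the class of such affine reconstructions $\mathcal{R}$ and arbitrary measurable projections $\mathcal{P}:L^2(U)\to\mathbb{R}^p$, is minimized by the choice $$\mathcal{R}_{\mathrm{opt}}(\alpha_1,\dots,\alpha_p)=\hat\tau_0+\sum_{j=1}^p\alpha_j\hat\tau_j ,$$ where $\hat\tau_0=\mathbb{E}_\nu[v]=\int_{L^2(U)}v\,d\nu(v)$ and $\hat\tau_1,\dots,\hat\tau_p$ are $p$ orthonormal eigenvectors of the covariance operator $\Gamma=\int(v-\mathbb{E}_\nu[v])\otimes(v-\mathbb{E}_\nu[v])\,d\nu(v)$ corresponding to the $p$ largest eigenvalues $\lambda_1\ge\lambda_2\ge\dots\ge\lambda_p\ge\dots$. Furthermore, the optimal reconstruction error satisfies the lower bound $$\widehat{\mathscr{E}}_{\mathcal{R}_{\mathrm{opt}}}\ge\sqrt{\sum_{k>p}\lambda_k}$$ in terms of the spectrum $\lambda_1\ge\lambda_2\ge\dots$ of $\Gamma$ (eigenvalues repeated according to multiplicity). Given $\mathcal{R}_{\mathrm{opt}}$,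 the corresponding optimal measurable projection $\mathcal{P}:L^2(U)\to\mathbb{R}^p$ is affine and is given by $$\mathcal{P}(v)=\left(\langle v-\hat\tau_0,\hat\tau_1\rangle,\dots,\langle v-\hat\tau_0,\hat\tau_p\rangle\right).$$
   Context: $U\subset\mathbb{R}^n$ is a compact domain. $\mathcal{G}_\#\mu$ is the push-forward under a Borel measurable operator $\mathcal{G}:X\to L^2(U)$ of a probability measure $\mu$ on a separable Banach space $X$, with $\int_X\|\mathcal{G}(u)\|_{L^2(U)}^2\,d\mu(u)<\infty$. $\widehat{\mathscr{E}}_{\mathcal{R}_{\mathrm{opt}}}$ denotes the displayed reconstruction error for $\mathcal{R}=\mathcal{R}_{\mathrm{opt}}$ with its optimal projection. *)

(* Defs.v *)
From HB Require Import structures.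
From mathcomp Require Import all_boot all_order all_algebra.
From mathcomp Require Import all_classical all_reals all_analysis.
From mathcomp Require Import measurable_realfun ess_sup_inf.

Set Implicit Arguments.
Unset Strict Implicit.
Unset Printing Implicit Defensive.

Import Order.TTheory GRing.Theory Num.Theory.
Import numFieldNormedType.Exports.

Local Open Scope classical_set_scope.
Local Open Scope ring_scope.

(* Lp(mu) as a normed space.  The library provides the type [LspaceType mu p1]
   of classes of p-integrable functions modulo a.e. equality; it is given here
   its vector space structure and the norm 'N[mu]_p. *)

Section Lspace_normed.
Context d (T : measurableType d) (R : realType).
Variables (mu : {measure set T -> \bar R}) (p : \bar R) (p1 : (1 <= p)%E).

Local Notation Lp := (LspaceType mu p1).
Local Notation Q := {mfun_ mu, T >-> measurableTypeR R}.

HB.instance Definition _ := gen_eqMixin Lp.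
HB.instance Definition _ := gen_choiceMixin Lp.

Lemma ae_eq_Lnorm (f g : T -> R) :
  measurable_fun setT f -> measurable_fun setT g -> f = g %[ae mu] ->
  ('N[mu]_p[EFin \o f] = 'N[mu]_p[EFin \o g])%E.
Proof.
move=> mf mg fg; rewrite unlock /Lnorm.
case: p p1 => [r _|_|//].
- have mfun_pow (h : T -> R) : measurable_fun setT h ->
      measurable_fun setT (fun x => `|(EFin \o h) x| `^ r)%E.
    move=> mh; apply: (measurableT_comp (measurable_poweR _)).
    by apply: measurableT_comp => //; exact/measurable_EFinP.
  apply: (congr1 (fun y => (y `^ r^-1)%E)); apply: ae_eq_integral.
  + exact: measurableT.
  + exact: mfun_pow.
  + exact: mfun_pow.
  + by apply: filterS fg => x /= /(_ I) fgx _; rewrite /= fgx.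
- case: ifP => // _; apply: eq_ess_sup.
  by apply: filterS fg => x /= /(_ I) fgx; rewrite /= fgx.
Qed.

Definition Lspace_fun (f : Lp) : T -> R := f.

Lemma Lspace_fun_measurable (f : Lp) : measurable_fun setT (Lspace_fun f).
Proof.
rewrite /Lspace_fun /aqEqMfun_to_fun.
exact: (measurable_funPT (repr (LebesgueSpace.sort f))).
Qed.

Lemma Lspace_fun_Lfun (f : Lp) : Lspace_fun f \in Lfun mu p.
Proof.
rewrite inE; apply/andP; split; rewrite inE/=.
  exact: Lspace_fun_measurable.
exact: Lebesgue_finite.
Qed.

Section Lspace_class.
Variables (g : T -> R) (gP : g \in Lfun mu p).

Definition Lspace_mfun : {mfun T >-> measurableTypeR R} :=
  @mfun_Sub _ _ T (measurableTypeR R) g (sub_Lfun_mfun gP).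
Definition Lspace_quot : Q :=
  \pi_({mfun_ mu, T >-> measurableTypeR R})%qT Lspace_mfun.

Lemma Lspace_quot_ae : (Lspace_quot : T -> R) = g %[ae mu].
Proof.
by have /eqmodP /asboolP := reprK Lspace_quot.
Qed.
Lemma Lspace_quot_finite : finite_norm mu p Lspace_quot.
Proof.
have /andP[/[!inE]/= mg lg] := gP.
rewrite /finite_norm (ae_eq_Lnorm _ _ Lspace_quot_ae)//.
exact: (measurable_funPT (repr Lspace_quot)).
Qed.

HB.instance Definition _ := isFinLebesgue.Build d T R mu p p1 Lspace_quot
  Lspace_quot_finite.

Definition Lspace_class : Lp := Lspace_quot.

Lemma Lspace_classE : Lspace_fun Lspace_class = g %[ae mu].
Proof. exact: Lspace_quot_ae. Qed.

End Lspace_class.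

Lemma Lspace_eqP (f g : Lp) : f = g <-> Lspace_fun f = Lspace_fun g %[ae mu].
Proof.
split=> [->|fg]; first exact: ae_eq_refl.
have fgE : LebesgueSpace.sort f = LebesgueSpace.sort g :> Q.
  have : \pi_({mfun_ mu, T >-> measurableTypeR R})%qT (repr (LebesgueSpace.sort f))
       = \pi_({mfun_ mu, T >-> measurableTypeR R})%qT (repr (LebesgueSpace.sort g)).
    by apply/eqmodP/asboolP.
  by rewrite !reprK.
case: f g fg fgE => [f [[f1]]] [g [[g1]]] /= _ fg.
case: _ / fg in g1 *.
by rewrite (Prop_irrelevance f1 g1).
Qed.
End Lspace_normed.

Section Lspace_lmod.
Context d (T : measurableType d) (R : realType).
Variables (mu : {measure set T -> \bar R}) (p : \bar R) (p1 : (1 <= p)%E).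

Local Notation Lp := (LspaceType mu p1).

Definition Lspace_zero : Lp := Lspace_class p1 (Lfun_addr_closed mu p1).1.

Definition Lspace_opp (f : Lp) : Lp :=
  Lspace_class p1 (Lfun_oppr_closed (Lspace_fun_Lfun f)).

Definition Lspace_add (f g : Lp) : Lp :=
  Lspace_class p1
    ((Lfun_addr_closed mu p1).2 _ _ (Lspace_fun_Lfun f) (Lspace_fun_Lfun g)).

Lemma Lfun_scaler_closed a (f : T -> R) :
  f \in Lfun mu p -> a *: f \in Lfun mu p.
Proof.
move=> fL; rewrite -[a *: f]addr0.
exact: (Lfun_submod_closed mu p1).2 fL (Lfun_addr_closed mu p1).1.
Qed.

Definition Lspace_scale (a : R) (f : Lp) : Lp :=
  Lspace_class p1 (Lfun_scaler_closed a (Lspace_fun_Lfun f)).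

Let aeP (f g : Lp) :
  (\forall x \ae mu, Lspace_fun f x = Lspace_fun g x) -> f = g.
Proof. by move=> fg; apply/Lspace_eqP; apply: filterS fg => x + _. Qed.

Lemma Lspace_zeroE : \forall x \ae mu, Lspace_fun Lspace_zero x = 0.
Proof.
have := @Lspace_classE _ _ _ _ _ p1 _ (Lfun_addr_closed mu p1).1.
by apply: filterS => x /(_ I).
Qed.

Lemma Lspace_oppE (f : Lp) :
  \forall x \ae mu, Lspace_fun (Lspace_opp f) x = - Lspace_fun f x.
Proof.
have := @Lspace_classE _ _ _ _ _ p1 _ (Lfun_oppr_closed (Lspace_fun_Lfun f)).
by apply: filterS => x /(_ I).
Qed.

Lemma Lspace_addE (f g : Lp) : \forall x \ae mu,
  Lspace_fun (Lspace_add f g) x = Lspace_fun f x + Lspace_fun g x.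
Proof.
have := @Lspace_classE _ _ _ _ _ p1 _ ((Lfun_addr_closed mu p1).2 _ _
  (Lspace_fun_Lfun f) (Lspace_fun_Lfun g)).
by apply: filterS => x /(_ I).
Qed.

Lemma Lspace_scaleE a (f : Lp) : \forall x \ae mu,
  Lspace_fun (Lspace_scale a f) x = a * Lspace_fun f x.
Proof.
have := @Lspace_classE _ _ _ _ _ p1 _ (Lfun_scaler_closed a (Lspace_fun_Lfun f)).
by apply: filterS => x /(_ I).
Qed.

Let aeI (A B : T -> Prop) : (\forall x \ae mu, A x) ->
  (\forall x \ae mu, B x) -> \forall x \ae mu, A x /\ B x.
Proof. exact: filterI. Qed.

Let addA : associative Lspace_add.
Proof.
move=> f g h; apply: aeP.
have H := aeI (aeI (Lspace_addE f (Lspace_add g h)) (Lspace_addE g h))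
  (aeI (Lspace_addE (Lspace_add f g) h) (Lspace_addE f g)).
by apply: filterS H => x [[-> ->] [-> ->]]; rewrite addrA.
Qed.

Let addC : commutative Lspace_add.
Proof.
move=> f g; apply: aeP.
have H := aeI (Lspace_addE f g) (Lspace_addE g f).
by apply: filterS H => x [-> ->]; rewrite addrC.
Qed.

Let add0 : left_id Lspace_zero Lspace_add.
Proof.
move=> f; apply: aeP.
have H := aeI (Lspace_addE Lspace_zero f) Lspace_zeroE.
by apply: filterS H => x [-> ->]; rewrite add0r.
Qed.

Let addN : left_inverse Lspace_zero Lspace_opp Lspace_add.
Proof.
move=> f; apply: aeP.
have H := aeI (Lspace_addE (Lspace_opp f) f)
  (aeI (Lspace_oppE f) Lspace_zeroE).
by apply: filterS H => x [-> [-> ->]]; rewrite addNr.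
Qed.

HB.instance Definition _ := GRing.isZmodule.Build Lp addA addC add0 addN.

Let scaleA a b f :
  Lspace_scale a (Lspace_scale b f) = Lspace_scale (a * b) f.
Proof.
apply: aeP.
have H := aeI (Lspace_scaleE a (Lspace_scale b f))
  (aeI (Lspace_scaleE b f) (Lspace_scaleE (a * b) f)).
by apply: filterS H => x [-> [-> ->]]; rewrite mulrA.
Qed.

Let scale1 : left_id 1 Lspace_scale.
Proof.
move=> f; apply: aeP.
by apply: filterS (Lspace_scaleE 1 f) => x ->; rewrite mul1r.
Qed.

Let scaleDr : right_distributive Lspace_scale +%R.
Proof.
move=> a f g; apply: aeP.
have H := aeI (aeI (Lspace_scaleE a (Lspace_add f g)) (Lspace_addE f g))
  (aeI (Lspace_addE (Lspace_scale a f) (Lspace_scale a g))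
     (aeI (Lspace_scaleE a f) (Lspace_scaleE a g))).
by apply: filterS H => x [[-> ->] [-> [-> ->]]]; rewrite mulrDr.
Qed.

Let scaleDl f : {morph Lspace_scale^~ f : a b / a + b}.
Proof.
move=> a b; apply: aeP.
have H := aeI (Lspace_scaleE (a + b) f)
  (aeI (Lspace_addE (Lspace_scale a f) (Lspace_scale b f))
     (aeI (Lspace_scaleE a f) (Lspace_scaleE b f))).
by apply: filterS H => x [-> [-> [-> ->]]]; rewrite mulrDl.
Qed.

HB.instance Definition _ := GRing.Zmodule_isLmodule.Build R Lp
  scaleA scale1 scaleDr scaleDl.

Definition Lspace_norm (f : Lp) : R := fine ('N[mu]_p[EFin \o Lspace_fun f])%E.

Let LfunE (f : Lp) : LfunType mu p1 := Lfun_Sub p1 (Lspace_fun_Lfun f).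

Let norm_fun (f : Lp) (g : LfunType mu p1) :
  (\forall x \ae mu, Lspace_fun f x = g x) ->
  Lspace_norm f = fine ('N[mu]_p[EFin \o g])%E.
Proof.
move=> fg; congr fine; apply: ae_eq_Lnorm => //.
  exact: Lspace_fun_measurable.
by apply: filterS fg => x + _.
Qed.

Let normD (f g : Lp) : Lspace_norm (f + g) <= Lspace_norm f + Lspace_norm g.
Proof.
rewrite (@norm_fun (f + g) (LfunE f + LfunE g)); last exact: Lspace_addE.
exact: (ler_LnormD (LfunE f) (LfunE g)).
Qed.

Let normZ a (f : Lp) : Lspace_norm (a *: f) = `|a| * Lspace_norm f.
Proof.
rewrite (@norm_fun (a *: f) (a *: LfunE f)); last exact: Lspace_scaleE.
by rewrite [X in fine X](LnormZ (LfunE f) a) -finite_norm_fine -EFinM.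
Qed.

Let norm_eq0 (f : Lp) : Lspace_norm f = 0 -> f = 0.
Proof.
move=> /(fine_Lnormr_eq0 (f := LfunE f)) f0; apply: aeP.
by have H := aeI f0 Lspace_zeroE; apply: filterS H => x [/(_ I) + ->].
Qed.

HB.instance Definition _ := Lmodule_isNormed.Build R Lp normD normZ norm_eq0.

End Lspace_lmod.

(* [borel T] is convertible to [T], with the Borel sigma-algebra. *)
Notation borel T := (g_sigma_algebraType (@open T)).

Definition image_measure d1 d2 (T1 : measurableType d1) (T2 : measurableType d2)
    (R : realType) (m : {measure set T1 -> \bar R}) (f : T1 -> T2)
    (mf : measurable_fun setT f) : {measure set T2 -> \bar R} :=
  measure_function_pushforward__canonical__measure_function_Measure m mf.

Section lebesgue_rV.
Variable R : realType.
Local Notation mR := (measurableTypeR R).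
Local Open Scope ereal_scope.

Definition tuple_cons n (x : mR * n.-tuple mR) : n.+1.-tuple mR :=
  [tuple of x.1 :: x.2].

Lemma measurable_tuple_cons n : measurable_fun setT (@tuple_cons n).
Proof. exact: measurable_cons. Qed.

Section lebesgue_cons.
Variables (n : nat) (m : {sigma_finite_measure set (n.-tuple mR) -> \bar R}).

Definition lebesgue_cons : set (n.+1.-tuple mR) -> \bar R :=
  image_measure (@lebesgue_measure R \x m) (@measurable_tuple_cons n).

HB.instance Definition _ := Measure.on lebesgue_cons.

Let lebesgue_cons_sigma_finite : sigma_finite setT lebesgue_cons.
Proof.
have /sigma_finiteP[F [FT ndF Ffin]] := sigma_finiteT (@lebesgue_measure R).
have /sigma_finiteP[G [GT ndG Gfin]] := sigma_finiteT m.
exists (fun k => [set t : n.+1.-tuple mR |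
    F k (thead t) /\ G k [tuple of behead t]]).
  apply/esym/seteqP; split=> // t _.
  have [i _ Fi] : (\bigcup_i F i) (thead t) by rewrite -FT.
  have [j _ Gj] : (\bigcup_j G j) [tuple of behead t] by rewrite -GT.
  exists (maxn i j) => //; split.
  - by move: Fi; exact/subsetPset/ndF/leq_maxl.
  - by move: Gj; exact/subsetPset/ndG/leq_maxr.
move=> k; have [mF Fk] := Ffin k; have [mG Gk] := Gfin k; split.
  apply: measurableI.
    by rewrite -[X in measurable X]setTI; exact: measurable_tnth.
  by rewrite -[X in measurable X]setTI; exact: measurable_behead.
rewrite /lebesgue_cons /= /pushforward (_ : _ @^-1` _ = F k `*` G k).
  by rewrite product_measure1E// lte_mul_pinfty// ge0_fin_numE.
apply/funext => -[x t].
have xE : thead (tuple_cons (x, t)) = x by exact: theadE.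
have tE : [tuple of behead (tuple_cons (x, t))] = t by exact/val_inj.
by rewrite /preimage /setX /mkset xE tE.
Qed.

HB.instance Definition _ := Measure_isSigmaFinite.Build _ _ _ lebesgue_cons
  lebesgue_cons_sigma_finite.

End lebesgue_cons.

(* n-fold product of the Lebesgue measure on the line, by
   R^(n+1) = R x R^n. *)
Fixpoint lebesgue_tuple n :
    {sigma_finite_measure set (n.-tuple mR) -> \bar R} :=
  if n is k.+1 then lebesgue_cons (lebesgue_tuple k)
  else dirac ([tuple] : 0.-tuple mR).

Definition row_of_tuple n (t : n.-tuple mR) : borel 'rV[R]_n :=
  (\row_i tnth t i)%R.

Lemma measurable_row_of_tuple n : measurable_fun setT (@row_of_tuple n).
Proof.
apply: (@measurability _ _ _ (borel 'rV[R]_n) setT (@row_of_tuple n) (@open 'rV[R]_n)); first by [].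
move=> B0 [V oV <-].
rewrite setTI.
pose F (qk : {ffun 'I_n -> rat} * nat) : set (n.-tuple mR) :=
  [set t | forall i, (`|ratr (qk.1 i) - tnth t i| < qk.2.+1%:R^-1 :> R)%R].
pose B (qk : {ffun 'I_n -> rat} * nat) := `[< F qk `<=` @row_of_tuple n @^-1` V >].
rewrite (_ : _ @^-1` _ = \bigcup_qk (if B qk then F qk else set0)).
  apply: countable_bigcupT_measurable => // qk; case: ifP => // _.
  rewrite (_ : F qk = \bigcap_(i in [set: 'I_n])
      ((fun t => tnth t i) @^-1` ball (ratr (qk.1 i) : R) qk.2.+1%:R^-1)).
    apply: fin_bigcap_measurable => // i _.
    by rewrite -[X in measurable X]setTI; apply: measurable_tnth => //;
      exact: measurable_ball.
  by apply/seteqP; split=> t /= Ft i => [_|]; exact: Ft.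
apply/seteqP; split=> [t Vt|t [qk _]]; last first.
  by case: ifPn => // /asboolP; exact.
have : nbhs (row_of_tuple t : 'rV[R]_n) V by exact: open_nbhs_nbhs.
move=> /nbhs_ballP[e /= e0 eV].
have [k ke] : exists k, (k.+1%:R^-1 < e / 2 :> R)%R.
  have := near_infty_natSinv_lt (PosNum (divr_gt0 e0 (ltr0Sn R 1))).
  by move=> [k _ /(_ k (leqnn k))]; exists k.
have k0 : (0 < k.+1%:R^-1 :> R)%R by rewrite invr_gt0.
have qP i : exists q : rat, (`|ratr q - tnth t i| < k.+1%:R^-1 :> R)%R.
  have [|q] := @rat_in_itvoo R (tnth t i) (tnth t i + k.+1%:R^-1)%R.
    by rewrite ltrDl.
  rewrite in_itv/= => /andP[tq qt]; exists q.
  by rewrite ger0_norm ?subr_ge0 1?ltW// ltrBlDl.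
exists ([ffun i => projT1 (cid (qP i))], k) => //.
have Ft : F ([ffun i => projT1 (cid (qP i))], k) t.
  by move=> i /=; rewrite ffunE; case: cid.
suff -> : B ([ffun i => projT1 (cid (qP i))], k) by [].
apply/asboolP => s Fs; apply: eV; split=> // i j; rewrite !mxE /ball/=.
have -> : (tnth t j - tnth s j =
    (ratr ([ffun i => projT1 (cid (qP i))] j) - tnth s j) -
    (ratr ([ffun i => projT1 (cid (qP i))] j) - tnth t j))%R.
  by rewrite opprB [RHS]addrC addrA subrK.
apply: (le_lt_trans (ler_normB _ _)).
by rewrite (splitr e) ltrD// (lt_trans _ ke).
Qed.

(* Lebesgue measure on the Borel sets of R^n, with R^n as row vectors. *)
Definition lebesgue_rV n : {measure set (borel 'rV[R]_n) -> \bar R} :=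
  image_measure (lebesgue_tuple n) (@measurable_row_of_tuple n).

End lebesgue_rV.

Section domain.
Context (R : realType) (n : nat).

Definition separable_space (T : topologicalType) :=
  exists2 D : set T, countable D & dense D.

(* A domain is a nonempty connected open set; a compact domain is the closure
   of a bounded one. *)
Definition compact_domain (U : set 'rV[R]_n) :=
  compact U /\
  exists V, [/\ open V, V !=set0, connected V & U = closure V].

Lemma compact_domain_borel (U : set 'rV[R]_n) :
  compact_domain U -> measurable (U : set (borel 'rV[R]_n)).
Proof.
move=> [cU _]; rewrite -[U]setCK; apply: measurableC.
apply: sub_sigma_algebra; apply: closed_openC.
by apply: compact_closed => //; exact: norm_hausdorff.
Qed.

(* L^2 of U with respect to Lebesgue measure: functions on R^n modulo equality
   a.e. on U, square-integrable on U. *)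
Definition L2 (U : set 'rV[R]_n) (dU : compact_domain U) :=
  LspaceType2 (mrestr (@lebesgue_rV R n) (compact_domain_borel dU)).

End domain.

Section hilbert.
Context d (T : measurableType d) (R : realType) (mu : {measure set T -> \bar R}).
Local Notation H := (LspaceType2 mu).

Definition l2dot (f g : H) : R := \int[mu]_x (f x * g x).

(* The integral of a vector-valued map, as the element m representing
   w |-> \int <f v, w>; such an m is unique, exists when the norm of f is
   integrable and f is weakly measurable, and is the Bochner integral when f is
   Bochner integrable. *)
Definition l2integral (nu : {measure set (borel H) -> \bar R}) (f : H -> H) : H :=
  xget 0 [set m : H | forall w,
    nu.-integrable [set: borel H] (fun v => (l2dot (f v) w)%:E) /\
    l2dot m w = \int[nu]_v l2dot (f v) w].

(* (a (x) b) w = <b, w> a *)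
Definition l2tensor (a b w : H) : H := l2dot b w *: a.

Definition l2mean (nu : {measure set (borel H) -> \bar R}) : H := l2integral nu id.

(* The covariance operator \int (v - E v) (x) (v - E v), integrated pointwise. *)
Definition covariance_op (nu : {measure set (borel H) -> \bar R}) (w : H) : H :=
  l2integral nu (fun v => l2tensor (v - l2mean nu) (v - l2mean nu) w).

Definition l2orthonormal (I : eqType) (e : I -> H) :=
  forall i j, l2dot (e i) (e j) = (i == j)%:R.

(* lam 0 >= lam 1 >= ... lists the eigenvalues of A with multiplicity: for every
   c != 0 the e k with lam k = c form an orthonormal basis of the eigenspace of
   c.  Since the list is infinite, when A has finite rank the nonzero
   eigenvalues are followed by zeros; when A is positive with infinitely many
   nonzero eigenvalues, the eigenvalue 0 is not listed. *)
Definition ordered_spectrum (A : H -> H) (lam : nat -> R) :=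
  nonincreasing_seq lam /\
  exists e : nat -> H, [/\ l2orthonormal e,
    forall k, A (e k) = lam k *: e k &
    forall c w, c != 0 -> A w = c *: w ->
      exists N, w = \sum_(k < N | lam k == c) l2dot w (e k) *: e k].

Section reconstruction.
Variable p : nat.

Definition affine_reconstruction (tau0 : H) (tau : 'I_p -> H) (a : 'rV[R]_p) : H :=
  tau0 + \sum_j a ord0 j *: tau j.

Definition affine_projection (tau0 : H) (tau : 'I_p -> H) (v : H) : 'rV[R]_p :=
  \row_j l2dot (v - tau0) (tau j).

Definition reconstruction_error (nu : {measure set (borel H) -> \bar R})
    (Rec : 'rV[R]_p -> H) (P : H -> 'rV[R]_p) : \bar R :=
  sqrte (\int[nu]_v (`|Rec (P v) - v| ^+ 2)%:E)%E.

Definition measurable_projection (P : H -> 'rV[R]_p) :=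
  measurable_fun [set: borel H] (P : borel H -> borel 'rV[R]_p).

End reconstruction.
End hilbert.

Definition affine_map (R : realType) (V W : lmodType R) (f : V -> W) :=
  forall (t : R) v w, f (t *: v + (1 - t) *: w) = t *: f v + (1 - t) *: f w.

(* Main.v *)
(* Let m be the mean of nu and B(w, z) the integral of <v - m, w><v - m, z>, the
   form of Gamma; both m and Gamma exist by Riesz representation, L2 being
   complete.  An affine reconstruction takes its values in c + W with dim W <= p,
   so its squared error at v is at least the squared distance from v to c + W,
   whose integral is at least the integral of |v - m|^2 minus the trace of B on W;
   equality holds when c = m and P is the orthogonal projection.  It remains to see
   that the trace of B on W is at most lam 0 + ... + lam (p - 1) (Ky Fan).  The
   trace of B on any orthonormal family is bounded by the total variance, so B is
   small off some finite-dimensional subspace and its supremum over the unit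
   vectors of a closed Gamma-invariant subspace is attained, at an eigenvector, when
   positive.  Applied to the orthogonal complement of the first p eigenvectors,
   which contains no eigenvector of an eigenvalue greater than lam p, this bounds B
   there by lam p. *)
Require Import Defs.
From HB Require Import structures.
From mathcomp Require Import all_boot all_order all_algebra.
From mathcomp Require Import all_classical all_reals all_analysis.
From mathcomp Require Import measurable_realfun ess_sup_inf.
From mathcomp Require Import ring lra.

Set Implicit Arguments.
Unset Strict Implicit.
Unset Printing Implicit Defensive.

Import Order.TTheory GRing.Theory Num.Theory.
Import numFieldNormedType.Exports.

Local Open Scope classical_set_scope.
Local Open Scope ring_scope.

(** * Symmetric bilinear forms and orthonormal families *)

(** The discriminant is nonpositive, as evaluation at the minimizer [- b / c] shows. When [c = 0]
    the polynomial is affine in [t], and a nonzero [b] would let it take the value -1. *)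
Lemma quadratic_ge0 (R : realFieldType) (a b c : R) : 0 <= c ->
  (forall t, 0 <= a + 2 * t * b + t ^+ 2 * c) -> b ^+ 2 <= a * c.
Proof.
rewrite le_eqVlt => /predU1P[<-|c0] h.
  rewrite mulr0; have [->|b0] := eqVneq b 0; first by rewrite expr0n.
  have := h (- (a + 1) / (2 * b)).
  have -> : a + 2 * (- (a + 1) / (2 * b)) * b = -1 by field.
  by lra.
have := h (- b / c).
have -> : a + 2 * (- b / c) * b + (- b / c) ^+ 2 * c = (a * c - b ^+ 2) / c.
  by field; rewrite gt_eqF.
by rewrite pmulr_lge0 ?invr_gt0// subr_ge0.
Qed.

Record symmetric_bilinear (R : pzRingType) (V : lmodType R) (B : V -> V -> R) : Prop :=
  SymmetricBilinear {
    formC : forall x y, B x y = B y x;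
    formDl : forall x y z, B (x + y) z = B x z + B y z;
    formZl : forall a x y, B (a *: x) y = a * B x y }.

(** The empty set qualifies; in a nonempty one, [0] is obtained from a member with [a = -1] and
    [y = x]. *)
Definition linear_set (R : pzRingType) (V : lmodType R) (M : set V) :=
  forall a x y, M x -> M y -> M (a *: x + y).

Section symmetric_bilinear.
Context (R : realFieldType) (V : lmodType R) (B : V -> V -> R).
Hypothesis BP : symmetric_bilinear B.

Lemma formDr x y z : B x (y + z) = B x y + B x z.
Proof. by rewrite formC// formDl// !(formC BP x). Qed.

Lemma formZr a x y : B x (a *: y) = a * B x y.
Proof. by rewrite formC// formZl// (formC BP x). Qed.

Lemma formNl x y : B (- x) y = - B x y.
Proof. by rewrite -scaleN1r formZl// mulN1r. Qed.

Lemma formNr x y : B x (- y) = - B x y.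
Proof. by rewrite formC// formNl (formC BP x). Qed.

Lemma formBl x y z : B (x - y) z = B x z - B y z.
Proof. by rewrite formDl// formNl. Qed.

Lemma formBr x y z : B x (y - z) = B x y - B x z.
Proof. by rewrite formDr formNr. Qed.

Lemma form0l x : B 0 x = 0.
Proof. by rewrite -(scale0r x) formZl// mul0r. Qed.

Lemma form_suml I (r : seq I) (P : pred I) (F : I -> V) x :
  B (\sum_(i <- r | P i) F i) x = \sum_(i <- r | P i) B (F i) x.
Proof.
by elim/big_rec2: _ => [|i y z _ <-]; [rewrite form0l|rewrite formDl].
Qed.

Lemma form_sumr I (r : seq I) (P : pred I) (F : I -> V) x :
  B x (\sum_(i <- r | P i) F i) = \sum_(i <- r | P i) B x (F i).
Proof. by rewrite formC// form_suml; apply: eq_bigr => i _; exact: formC. Qed.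

Lemma form_sqrD x y : B (x + y) (x + y) = B x x + 2 * B x y + B y y.
Proof. by rewrite formDl// !formDr (formC BP y x); ring. Qed.

Lemma form_sqrB x y : B (x - y) (x - y) = B x x - 2 * B x y + B y y.
Proof. by rewrite form_sqrD formNl !formNr; ring. Qed.

Section semidefinite.
Variable M : set V.
Hypotheses (linM : linear_set M) (B0 : forall x, M x -> 0 <= B x x).

Lemma linear_set_sub x y : M x -> M y -> M (x - y).
Proof. by move=> Mx My; rewrite addrC -scaleN1r; exact: linM. Qed.

(** Discriminant of [t |-> B (x + t *: y) (x + t *: y)]. Positivity is required on [M] alone so as
    to cover [m * dot - B], with [m] the maximum of [B] on the unit vectors of [M]. *)
Lemma form_cauchy_schwarz x y : M x -> M y -> B x y ^+ 2 <= B x x * B y y.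
Proof.
move=> Mx My; apply: quadratic_ge0 => [|t]; first exact: B0.
have := B0 (linM t My Mx).
by rewrite form_sqrD formZl// formZr formZl// (formC BP y x); congr (0 <= _); ring.
Qed.

(** Parallelogram law: the two sides differ by [B (x + y) (x + y)]. *)
Lemma form_sqrB_le x y : M x -> M y -> B (x - y) (x - y) <= 2 * B x x + 2 * B y y.
Proof.
move=> Mx My; have : M (x + y) by rewrite -[x]scale1r; exact: linM.
by move=> /B0; rewrite form_sqrD form_sqrB; lra.
Qed.

End semidefinite.
End symmetric_bilinear.

Record inner_product (R : realType) (H : normedModType R) (dot : H -> H -> R) : Prop :=
  InnerProduct {
    inner_form :> symmetric_bilinear dot;
    dot_sqr : forall x, dot x x = `|x| ^+ 2 }.

Definition orthonormal (R : pzRingType) (H I : eqType) (dot : H -> H -> R) (e : I -> H) :=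
  forall i j, dot (e i) (e j) = (i == j)%:R.

Section inner_product.
Context (R : realType) (H : normedModType R) (dot : H -> H -> R).
Hypothesis dotP : inner_product dot.
Let dotF : symmetric_bilinear dot := dotP.

Lemma dot_eq0 x : dot x x = 0 -> x = 0.
Proof. by rewrite dot_sqr// => /eqP; rewrite expf_eq0/= => /eqP/normr0_eq0. Qed.

Lemma dot_le x y : `|dot x y| <= `|x| * `|y|.
Proof.
rewrite -ler_sqr ?nnegrE ?mulr_ge0// exprMn -!(dot_sqr dotP) real_normK ?num_real//.
have linT : linear_set [set: H] by [].
by apply: (form_cauchy_schwarz dotF linT) => // z _; rewrite dot_sqr// sqr_ge0.
Qed.

Lemma bounded_additive_continuous (f : H -> R) C :
  (forall x y, f (x - y) = f x - f y) -> (forall x, `|f x| <= C * `|x|) ->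
  continuous f.
Proof.
move=> fB fC x; apply/cvgrPdist_le => e e0.
have C1 : 0 < `|C| + 1 by rewrite ltr_wpDl.
near=> y; rewrite -fB (le_trans (fC _))//.
rewrite (@le_trans _ _ ((`|C| + 1) * `|x - y|))// ?ler_wpM2r//.
  by rewrite (le_trans (ler_norm C))// lerDl.
rewrite -ler_pdivlMl//; near: y.
by apply: cvgr_dist_le => //; rewrite mulr_gt0 ?invr_gt0.
Unshelve. all: by end_near. Qed.

Lemma dot_continuous y : continuous (dot^~ y).
Proof.
apply: (@bounded_additive_continuous _ `|y|) => [x z|x]; first exact: formBl.
by rewrite mulrC dot_le.
Qed.

Section orthonormal_fin.
Context (I : finType) (s : I -> H).
Hypothesis os : orthonormal dot s.

Lemma dot_sum_orthonormal (a : I -> R) j : dot (\sum_i a i *: s i) (s j) = a j.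
Proof.
rewrite form_suml// (bigD1 j)//= formZl// os eqxx mulr1 big1 ?addr0// => i ij.
by rewrite formZl// os (negbTE ij) mulr0.
Qed.

Lemma norm_sum_orthonormal (a : I -> R) : `|\sum_i a i *: s i| ^+ 2 = \sum_i a i ^+ 2.
Proof.
rewrite -(dot_sqr dotP) form_sumr//; apply: eq_bigr => i _.
by rewrite formZr// dot_sum_orthonormal.
Qed.

(** Pythagoras: the first term is the squared distance from [x] to the span of [s], the second is
    the price of coefficients other than the Fourier coefficients. Bessel's inequality and both the
    optimality and the uniqueness of the projection come from it. *)
Lemma dist_sum_orthonormal (a : I -> R) x : `|\sum_i a i *: s i - x| ^+ 2 =
  (`|x| ^+ 2 - \sum_i dot x (s i) ^+ 2) + \sum_i (a i - dot x (s i)) ^+ 2.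
Proof.
have -> : \sum_i (a i - dot x (s i)) ^+ 2 =
    \sum_i a i ^+ 2 - 2 * \sum_i a i * dot x (s i) + \sum_i dot x (s i) ^+ 2.
  by rewrite mulr_sumr -sumrB -big_split; apply: eq_bigr => i _ /=; ring.
rewrite -[LHS](dot_sqr dotP) form_sqrB// !(dot_sqr dotP) norm_sum_orthonormal (form_suml dotF).
rewrite [X in 2 * X](eq_bigr (fun i => a i * dot x (s i))) => [|i _]; first by ring.
by rewrite formZl// (formC dotF x).
Qed.

Lemma bessel x : \sum_i dot x (s i) ^+ 2 <= `|x| ^+ 2.
Proof.
rewrite -subr_ge0; have := dist_sum_orthonormal (fun i => dot x (s i)) x.
rewrite [X in _ = _ + X]big1 => [|i _]; last by rewrite subrr expr0n.
by rewrite addr0 => <-.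
Qed.

Lemma dot_projection x j : dot (x - \sum_i dot x (s i) *: s i) (s j) = 0.
Proof. by rewrite formBl// dot_sum_orthonormal subrr. Qed.

End orthonormal_fin.

(** Families are indexed by [nat] and read on ['I_d], so that lengthening one keeps its type in the
    inductive constructions. *)
Lemma orthonormal_extend d (s : nat -> H) z :
  orthonormal dot (fun i : 'I_d => s i) -> (forall i : 'I_d, dot z (s i) = 0) ->
  `|z| = 1 -> orthonormal dot (fun i : 'I_d.+1 => if i == d :> nat then z else s i).
Proof.
move=> os zs z1 i j.
have lt (k : 'I_d.+1) : k != d :> nat -> (k < d)%N.
  by move=> kd; rewrite ltn_neqAle kd -ltnS ltn_ord.
rewrite -val_eqE /=; have [id|/[dup] nid /lt id] := eqVneq (i : nat) d;
  have [jd|/[dup] njd /lt jd] := eqVneq (j : nat) d.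
- by rewrite id jd eqxx dot_sqr// z1 expr1n.
- by rewrite id eq_sym (negbTE njd) (zs (Ordinal jd)).
- by rewrite jd (negbTE nid) formC// (zs (Ordinal id)).
- exact: (os (Ordinal id) (Ordinal jd)).
Qed.

(** A vector already in the span built so far is dropped, whence [d <= p] for a possibly dependent
    [sigma]. *)
Lemma gram_schmidt p (sigma : 'I_p -> H) : exists d (s : nat -> H),
  [/\ (d <= p)%N, orthonormal dot (fun i : 'I_d => s i) &
    forall a : 'I_p -> R, exists b : nat -> R,
      \sum_j a j *: sigma j = \sum_(i < d) b i *: s i].
Proof.
elim: p sigma => [|p IH] sigma.
  exists 0%N, (fun=> 0); split=> // [[]//|a]; exists (fun=> 0).
  by rewrite !big_ord0.
have [d [s [dp os sP]]] := IH (sigma \o widen_ord (leqnSn p)).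
pose t := sigma ord_max; pose u := \sum_(i < d) dot t (s i) *: s i.
have [tu|tu] := eqVneq (t - u) 0.
  exists d, s; split=> // [|a]; first exact: leqW.
  have [b bP] := sP (a \o widen_ord (leqnSn p)).
  exists (fun i => b i + a ord_max * dot t (s i)).
  rewrite big_ord_recr/= bP -/t (_ : t = u); last by apply/eqP; rewrite -subr_eq0 tu.
  rewrite {1}/u scaler_sumr -big_split/=; apply: eq_bigr => i _.
  by rewrite scalerA scalerDl; move/eqP: tu; rewrite subr_eq0 => /eqP <-.
pose z := `|t - u|^-1 *: (t - u).
have n0 : `|t - u| != 0 by rewrite normr_eq0.
have z1 : `|z| = 1 by rewrite normrZ normfV normr_id mulVf.
exists d.+1, (fun i => if i == d then z else s i); split=> // [|a].
  apply: orthonormal_extend => // i.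
  by rewrite formZl// (dot_projection os) mulr0.
have [b bP] := sP (a \o widen_ord (leqnSn p)).
(* These coefficients come from [t = u + |t - u| z], where [u] is expanded on the previous
   vectors. *)
exists (fun i => if i == d then a ord_max * `|t - u|
                 else b i + a ord_max * dot t (s i)).
rewrite !big_ord_recr/= eqxx bP scalerA -mulrA mulfV// mulr1.
under [X in _ = X + _]eq_bigr do rewrite ltn_eqF// scalerDl -scalerA.
rewrite big_split/= -scaler_sumr -/u -addrA; congr (_ + _).
by rewrite scalerBr subrKC.
Qed.

End inner_product.

(** * Hilbert spaces and forms with bounded trace *)

Lemma increasing_seq_ge_id (f : nat -> nat) : increasing_seq f -> forall n, (n <= f n)%N.
Proof.
move=> fi; elim=> // n /leq_ltn_trans; apply.
by move/increasing_seqP : fi => /(_ n).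
Qed.

Lemma increasing_seq_cvgn_pinfty (f : nat -> nat) : increasing_seq f -> f @ \oo --> \oo.
Proof.
move=> /increasing_seq_ge_id fge A [N _ NA]; exists N => // n /= Nn.
by apply: NA; exact: leq_trans (fge n).
Qed.

(** Successive extractions: each further subsequence keeps the coordinates treated before
    convergent. *)
Lemma bolzano_weierstrass_fin (R : realType) d (f : nat -> nat -> R) C :
  (forall i n, `|f i n| <= C) -> exists2 phi : nat -> nat,
    increasing_seq phi & forall i : 'I_d, cvgn (f i \o phi).
Proof.
move=> fC; elim: d => [|d [phi iphi cphi]]; first by exists id => // -[].
have [|psi ipsi cpsi] := @bolzano_weierstrass R (f d \o phi).
  exists C; split=> [|x Cx y _]; first exact: num_real.
  by rewrite /= (le_trans (fC _ _))// ltW.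
exists (phi \o psi) => [m n /=|i]; first by rewrite iphi -leEnat ipsi.
have [->//|id] := eqVneq (i : nat) d.
have {}id : (i < d)%N by rewrite ltn_neqAle id -ltnS ltn_ord.
have /cvg_ex[l fl] := cphi (Ordinal id).
apply/cvg_ex; exists l; apply: cvg_comp fl.
exact: increasing_seq_cvgn_pinfty.
Qed.

Definition seq_complete (H : uniformType) := forall u : nat -> H,
  cauchy (u @ \oo) -> exists l : H, u @ \oo --> l.

Lemma cauchy_normP (R : realType) (H : normedModType R) (u : nat -> H) :
  (forall e, 0 < e -> exists N, forall n m, (N <= n)%N -> (N <= m)%N -> `|u n - u m| <= e) ->
  cauchy (u @ \oo).
Proof.
move=> h; apply/cauchy_ballP => e e0.
have [N NP] := h (e / 2) (divr_gt0 e0 (ltr0n _ 2)).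
exists ([set u n | n in [set n | (N <= n)%N]], [set u n | n in [set n | (N <= n)%N]]) => /=.
  by split; exists N => // n Nn /=; exists n.
move=> [_ _] /= [[n Nn <-] [m Nm <-]].
by rewrite -ball_normE /= (le_lt_trans (NP _ _ Nn Nm))// ltr_pdivrMr// ltr_pMr// ltr1n.
Qed.

Section hilbert.
Context (R : realType) (H : normedModType R) (dot : H -> H -> R).
Hypotheses (dotP : inner_product dot) (cH : seq_complete H).
Let dotF : symmetric_bilinear dot := dotP.

(** The bound has the shape that the parallelogram law gives along an extremizing sequence. *)
Lemma cvg_of_sqr_dist (u : nat -> H) (a : nat -> R) : a @ \oo --> 0 ->
  (forall n m, `|u n - u m| ^+ 2 <= a n + a m) -> exists l : H, u @ \oo --> l.
Proof.
move=> a0 ua; apply/cH/cauchy_normP => e e0.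
have e2 : 0 < e ^+ 2 / 2 by rewrite divr_gt0// exprn_gt0.
have [N _ NP] := @cvgr_le _ _ _ _ _ _ a0 _ e2.
exists N => n m /NP an /NP am; rewrite -ler_sqr ?nnegrE ?(ltW e0)//.
by rewrite (le_trans (ua n m))// (splitr (e ^+ 2)) lerD.
Qed.

(** Variational argument: the representative is the minimizer of [J w = |w|^2 - 2 phi w], obtained
    as the limit of a minimizing sequence. *)
Lemma riesz_representation (phi : H -> R) C : scalar phi ->
  (forall x, `|phi x| <= C * `|x|) -> exists m, forall w, dot m w = phi w.
Proof.
move=> lphi phiC.
have phiB x y : phi (x - y) = phi x - phi y.
  by rewrite addrC -scaleN1r lphi mulN1r addrC.
have phi0 : phi 0 = 0 by rewrite -(subrr 0) phiB subrr.
have phiZ a x : phi (a *: x) = a * phi x by rewrite -[a *: x]addr0 lphi phi0 addr0.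
have phiD x y : phi (x + y) = phi x + phi y by rewrite -[x]scale1r lphi mul1r scale1r.
pose J w := `|w| ^+ 2 - 2 * phi w.
have JC w : - C ^+ 2 <= J w.
  have := phiC w; have := ler_norm (phi w); have := sqr_ge0 (`|w| - C); rewrite /J; nra.
have hJ : has_inf (range J).
  by split; [exists (J 0), 0|exists (- C ^+ 2) => _ [w _ <-]].
pose j := inf (range J).
have jJ w : j <= J w by apply: (ge_inf hJ.2); exists w.
have uP n : exists w, J w < j + n.+1%:R^-1.
  have [|_ [w _ <-] wj] := @inf_adherent R (range J) n.+1%:R^-1 _ hJ.
    by rewrite invr_gt0.
  by exists w.
have [u {}uP] := choice uP.
have [||m um] := @cvg_of_sqr_dist u (fun n => 2 * harmonic n).
- by rewrite -(mulr0 2); apply: cvgMr; exact: cvg_harmonic.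
(* The midpoint cannot go below the infimum, and [|u n - u k|^2] equals [2 J (u n) + 2 J (u k)]
   minus four times [J] at the midpoint. *)
- move=> n k; have := jJ (2^-1 *: (u n + u k)).
  have := uP n; have := uP k; rewrite /J /=.
  rewrite phiZ phiD -!(dot_sqr dotP) (formZl dotF) (formZr dotF) (form_sqrD dotF) (form_sqrB dotF).
  by move: n.+1%:R^-1 k.+1%:R^-1 => a b; lra.
exists m => w.
have Jm : J m <= j.
  have : (J \o u) @ \oo --> J m.
    apply: cvgB; first by apply: cvgM; exact: cvg_norm.
    apply: cvgMr; apply: continuous_cvg => //.
    exact: (bounded_additive_continuous phiB phiC).
  have : (fun n => j + harmonic n) @ \oo --> j.
    by rewrite -[X in _ --> X]addr0; apply: cvgD; [exact: cvg_cst|exact: cvg_harmonic].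
  move=> hj hJm; apply: (ler_cvg_to hJm hj).
  by apply: nearW => n /=; exact/ltW/uP.
(* First-order condition: [J (m + t *: w) - J m] is a nonnegative quadratic in [t] without constant
   term, so its linear coefficient vanishes. *)
have : (dot m w - phi w) ^+ 2 <= 0 * (`|w| ^+ 2).
  apply: quadratic_ge0 => [|t]; first exact: sqr_ge0.
  have := le_trans Jm (jJ (m + t *: w)); rewrite /J phiD phiZ -!(dot_sqr dotP).
  by rewrite (form_sqrD dotF) (formZl dotF) !(formZr dotF); lra.
by rewrite mul0r exprn_even_le0//= subr_eq0 => /eqP.
Qed.

Section form.
Context (B : H -> H -> R) (E : R) (M : set H).
Hypotheses (BF : symmetric_bilinear B) (B0 : forall x, 0 <= B x x).
Hypothesis trB : forall d (s : nat -> H), orthonormal dot (fun i : 'I_d => s i) ->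
  \sum_(i < d) B (s i) (s i) <= E.
Hypothesis linM : linear_set M.

Lemma form_le_trace x : B x x <= E * `|x| ^+ 2.
Proof.
have [->|x0] := eqVneq x 0; first by rewrite form0l// normr0 expr0n mulr0.
have n0 : `|x| != 0 by rewrite normr_eq0.
have := @trB 1 (fun=> `|x|^-1 *: x).
rewrite big_ord1 formZl// formZr// mulrA -invfM => h.
rewrite mulrC -ler_pdivrMl ?exprn_gt0 ?normr_gt0//; apply: h => i j.
by rewrite !ord1 eqxx formZl// formZr// (dot_sqr dotP) mulr1n; field.
Qed.

(** This replaces compactness. Otherwise unit vectors of [M] on which the form is at least [delta]
    could be picked orthogonally one after another, until their sum exceeds the trace bound [E]. *)
Lemma form_small_complement delta : 0 < delta -> exists d (s : nat -> H),
  [/\ orthonormal dot (fun i : 'I_d => s i), forall i : 'I_d, M (s i) &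
    forall z, M z -> (forall i : 'I_d, dot z (s i) = 0) -> B z z <= delta * `|z| ^+ 2].
Proof.
move=> delta0; apply: contrapT => nex.
have greedy N : exists s : nat -> H, orthonormal dot (fun i : 'I_N => s i) /\
    forall i : 'I_N, M (s i) /\ delta <= B (s i) (s i).
  elim: N => [|N [s [os sP]]]; first by exists (fun=> 0); split=> -[].
  have [z [Mz zs zB]] : exists z, [/\ M z, forall i : 'I_N, dot z (s i) = 0 &
      delta * `|z| ^+ 2 < B z z].
    apply: contrapT => nz; apply: nex; exists N, s; split=> // [i|z Mz zs].
      by have [] := sP i.
    by rewrite leNgt; apply/negP => zB; apply: nz; exists z.
  have z0 : z != 0 by apply: contraTneq zB => ->; rewrite form0l// normr0 expr0n mulr0 ltxx.
  have n0 : `|z| != 0 by rewrite normr_eq0.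
  exists (fun i => if i == N then `|z|^-1 *: z else s i); split.
    apply: orthonormal_extend => // [i|]; first by rewrite formZl// zs mulr0.
    by rewrite normrZ normfV normr_id mulVf.
  move=> i; have [iN|iN] := eqVneq (i : nat) N.
    split.
      have M0 : M 0 by have := linM (-1) Mz Mz; rewrite scaleN1r addNr.
      by rewrite -[_ *: _]addr0; exact: linM.
    rewrite formZl// formZr// mulrA -invfM mulrC ler_pdivlMr -?expr2 ?exprn_gt0 ?normr_gt0//.
    exact: ltW.
  have {}iN : (i < N)%N by rewrite ltn_neqAle iN -ltnS ltn_ord.
  exact: (sP (Ordinal iN)).
(* Chosen so that [N * delta] exceeds [E]. *)
pose N := (Num.truncn (E / delta)).+1.
have [s [/trB + sP]] := greedy N; apply/negP; rewrite -ltNge.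
apply: (@lt_le_trans _ _ (N%:R * delta)).
  by rewrite -ltr_pdivrMr// truncnS_gt.
rewrite mulr_natl -[X in _ *+ X](card_ord N) -sumr_const.
by apply: ler_sum => i _; have [] := sP i.
Qed.

Hypothesis clM : closed M.

(* Along a maximizing sequence the coordinates on a finite family converge after
   extraction, while off that family the form is below half its supremum: so the
   parallelogram law makes the sequence Cauchy. *)
Lemma form_max_attained c : 0 <= c -> (exists2 x, M x & c * `|x| ^+ 2 < B x x) ->
  exists x, [/\ M x, `|x| = 1, c < B x x &
    forall y, M y -> B y y <= B x x * `|y| ^+ 2].
Proof.
move=> c0 [x0 Mx0 x0B].
have M0 : M 0 by have := linM (-1) Mx0 Mx0; rewrite scaleN1r addNr.
have MZ a x : M x -> M (a *: x) by move=> Mx; rewrite -[_ *: _]addr0; exact: linM.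
pose S := [set B x x | x in [set x | M x /\ `|x| = 1]].
have normalize x : M x -> x != 0 -> S (B x x / `|x| ^+ 2).
  move=> Mx xn0; have n0 : `|x| != 0 by rewrite normr_eq0.
  exists (`|x|^-1 *: x); last by rewrite formZl// formZr//; field.
  by split; [exact: MZ|rewrite normrZ normfV normr_id mulVf].
have x0n0 : x0 != 0 by apply: contraTneq x0B => ->; rewrite form0l// normr0 expr0n mulr0 ltxx.
have hS : has_sup S.
  split; first by exists (B x0 x0 / `|x0| ^+ 2); exact: normalize.
  by exists E => _ [x [_ x1] <-]; have := form_le_trace x; rewrite x1 expr1n mulr1.
pose m := sup S.
have Bm y : M y -> B y y <= m * `|y| ^+ 2.
  move=> My; have [->|y0] := eqVneq y 0; first by rewrite form0l// normr0 expr0n mulr0.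
  rewrite -ler_pdivrMr ?exprn_gt0 ?normr_gt0//.
  by apply: (ub_le_sup hS.2); exact: normalize.
have cm : c < m.
  have p0 : 0 < `|x0| ^+ 2 by rewrite exprn_gt0 ?normr_gt0.
  by rewrite -(ltr_pM2r p0) (lt_le_trans x0B)// Bm.
have m0 : 0 < m by exact: le_lt_trans cm.
(* [Q] is nonnegative on [M], and a unit vector of [M] attains the supremum exactly when [Q]
   vanishes there. *)
pose Q x y := m * dot x y - B x y.
have QF : symmetric_bilinear Q.
  split=> [x y|x y z|a x y]; rewrite /Q.
  - by rewrite (formC dotF) (formC BF).
  - by rewrite formDl// (formDl BF); ring.
  - by rewrite formZl// (formZl BF); ring.
have Q0 x : M x -> 0 <= Q x x by move=> /Bm; rewrite /Q (dot_sqr dotP) subr_ge0.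
(* With the threshold [m / 4], the term [2 * B z z] below is at most [m / 2 * |z|^2], which
   [m * |D|^2] absorbs. *)
have [d [s [os Ms sP]]] := form_small_complement (divr_gt0 m0 (ltr0n _ 4)).
have vP n : exists x, [/\ M x, `|x| = 1 & Q x x < n.+1%:R^-1].
  have [|_ [x [Mx x1] <-] xm] := @sup_adherent R S n.+1%:R^-1 _ hS.
    by rewrite invr_gt0.
  by exists x; split=> //; rewrite /Q (dot_sqr dotP) x1 expr1n mulr1 ltrBlDr -ltrBlDl.
have [v {}vP] := choice vP.
(* The default 0 bounds [f i] by 1 for every natural [i], also beyond the family. *)
pose f i n := if (i < d)%N then dot (v n) (s i) else 0.
have [i n|phi iphi cphi] := @bolzano_weierstrass_fin R d f 1.
  rewrite /f; case: ifPn => [id|]; last by rewrite normr0.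
  have := os (Ordinal id) (Ordinal id); rewrite eqxx dot_sqr// => /eqP.
  rewrite sqrp_eq1// => /eqP s1.
  by have [_ v1 _] := vP n; rewrite (le_trans (dot_le dotP _ _))// v1 s1 mulr1.
pose u := v \o phi.
have phi_ge n : (n <= phi n)%N by exact: increasing_seq_ge_id.
have uQ n : Q (u n) (u n) <= harmonic n.
  have [_ _ /ltW/le_trans] := vP (phi n); apply.
  by rewrite lef_pV2 ?posrE// ler_nat ltnS.
have uM n : M (u n) by have [] := vP (phi n).
pose l (i : 'I_d) := lim (f i \o phi @ \oo).
pose b n := \sum_(i < d) (dot (u n) (s i) - l i) ^+ 2.
have [||x ux] := @cvg_of_sqr_dist u (fun n => 8 * b n + 4 / m * harmonic n).
- have b0 : b @ \oo --> 0.
    rewrite (_ : 0 = \sum_(i < d) 0 :> R); last by rewrite big1.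
    apply: cvg_big => [|i _]; first exact: add_continuous.
    rewrite -(mulr0 0); under eq_fun do rewrite expr2.
    have h : (fun n => dot (u n) (s i) - l i) @ \oo --> 0.
      apply/subr_cvg0; have := cphi i; rewrite /l /f.
      by under eq_fun do rewrite /= ltn_ord.
    exact: cvgM.
  rewrite (_ : 0 = 8 * 0 + 4 / m * 0); last by rewrite !mulr0 addr0.
  by apply: cvgD; apply: cvgMr => //; exact: cvg_harmonic.
(* [D] splits into [w] in the span of [s], controlled by the convergent coordinates, and [z]
   orthogonal to [s], where the form is small. *)
- move=> n k; set D := u n - u k; pose c' i := dot D (s i).
  pose w := \sum_(i < d) c' i *: s i; pose z := D - w.
  have MD : M D by exact: linear_set_sub.
  have Mw : M w.
    apply: (big_ind M) => // [y1 y2 My1 My2|i _].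
      by rewrite -[y1]scale1r; exact: linM.
    exact: MZ.
  have Mz : M z by exact: linear_set_sub.
  have zs (i : 'I_d) : dot z (s i) = 0 by exact: (dot_projection dotP os D i).
  have zD : `|z| ^+ 2 = `|D| ^+ 2 - \sum_(i < d) c' i ^+ 2.
    rewrite /z distrC (dist_sum_orthonormal dotP os) [X in _ + X]big1 ?addr0// => i _.
    by rewrite subrr expr0n.
  have wE : `|w| ^+ 2 = \sum_(i < d) c' i ^+ 2 by exact: (norm_sum_orthonormal dotP os).
  have BD : B D D <= 2 * B z z + 2 * B w w.
    have := form_sqrB_le BF linM (fun x _ => B0 x) Mz (MZ (-1) w Mw).
    by rewrite scaleN1r opprK (formNl BF) (formNr BF) opprK subrK.
  have QD := form_sqrB_le QF linM Q0 (uM n) (uM k).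
  have c'b : \sum_(i < d) c' i ^+ 2 <= 2 * b n + 2 * b k.
    rewrite /b !mulr_sumr -big_split; apply: ler_sum => i _ /=.
    rewrite /c' (formBl dotF); have := sqr_ge0 (dot (u n) (s i) - l i + (dot (u k) (s i) - l i)).
    by nra.
  have := uQ n; have := uQ k; have := sP z Mz zs; have := Bm w Mw.
  move: QD; rewrite -/D {1}/Q (dot_sqr dotP) zD wE; move: BD c'b.
  have : 0 <= \sum_(i < d) c' i ^+ 2 by apply: sumr_ge0 => i _; exact: sqr_ge0.
  move: (harmonic n) (harmonic k) => hn hk.
  set t := (\sum_(i < d) _) => t0 h1 h2 h3 h4 h5 h6 h7.
  have mt : m * t <= m * (2 * b n + 2 * b k) by rewrite ler_pM2l.
  have mt0 : 0 <= m * t by rewrite mulr_ge0// ltW.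
  rewrite -(ler_pM2l m0) [leRHS](_ : _ = m * (8 * b n + 8 * b k) + 4 * (hn + hk)).
    by move: h1 h3 h4 h5 h6 h7 mt mt0; lra.
  by field; rewrite gt_eqF.
have Mx : M x by apply: (closed_cvg _ clM _ _ ux); exact: nearW.
have nx : (fun n => `|u n|) @ \oo --> `|x| by exact: cvg_norm.
have x1 : `|x| = 1.
  apply: (cvg_unique _ nx) => //; rewrite (_ : (fun n => `|u n|) = cst 1); first exact: cvg_cst.
  by apply/funext => n /=; have [] := vP (phi n).
(* Writing [x = (x - u n) + u n] bounds [Q x x] by [2 m |x - u n|^2 + 2 / (n + 1)], which tends to
   0. *)
have QxE : Q x x <= 0.
  have hn : (fun n => 2 * harmonic n + 2 * (m * `|x - u n| ^+ 2)) @ \oo --> 0.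
    have xu : (fun n => `|x - u n|) @ \oo --> 0.
      by rewrite -(normr0 H) -(subrr x); apply: cvg_norm; apply: cvgB => //; exact: cvg_cst.
    rewrite (_ : 0 = 2 * 0 + 2 * (m * 0)); last by rewrite !mulr0 addr0.
    apply: cvgD; apply: cvgMr; first exact: cvg_harmonic.
    by apply: cvgMr; rewrite -(mulr0 0); under eq_fun do rewrite expr2; exact: cvgM.
  apply: (ler_cvg_to (cvg_cst _) hn); apply: nearW => n.
  have Mxu : M (x - u n) by exact: linear_set_sub.
  have := form_sqrB_le QF linM Q0 Mxu (MZ (-1) _ (uM n)).
  rewrite scaleN1r opprK subrK (formNl QF) (formNr QF) opprK => /le_trans; apply.
  have := uQ n; have : Q (x - u n) (x - u n) <= m * `|x - u n| ^+ 2.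
    by rewrite {1}/Q (dot_sqr dotP) lerBlDr lerDl.
  by move: (harmonic n) => h; lra.
have xm : B x x = m.
  apply/eqP; rewrite eq_le; have := Bm x Mx; rewrite x1 expr1n mulr1 => ->/=.
  by move: QxE; rewrite /Q (dot_sqr dotP) x1 expr1n mulr1 subr_le0.
by exists x; split=> //; rewrite xm.
Qed.

End form.
End hilbert.


(** * Maximizers as eigenvectors, and the Ky Fan inequality *)

Section spectrum.
Context (R : realType) (H : normedModType R) (dot : H -> H -> R).
Hypotheses (dotP : inner_product dot) (cH : seq_complete H).
Let dotF : symmetric_bilinear dot := dotP.
Context (B : H -> H -> R) (E : R) (Gamma : H -> H).
Hypotheses (BF : symmetric_bilinear B) (B0 : forall x, 0 <= B x x).
Hypothesis trB : forall d (s : nat -> H), orthonormal dot (fun i : 'I_d => s i) ->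
  \sum_(i < d) B (s i) (s i) <= E.
Hypothesis GammaB : forall w z, dot (Gamma w) z = B w z.

(** [Q = m * dot - B] is nonnegative on [M] and vanishes at [x], so by Cauchy-Schwarz [Q x z = 0]
    for all [z] in [M]. For [z = Gamma x - m *: x], in [M] by invariance, this reads [|z|^2 = 0]. *)
Lemma form_max_eigenvector (M : set H) x : linear_set M ->
  (forall y, M y -> M (Gamma y)) -> M x -> `|x| = 1 ->
  (forall y, M y -> B y y <= B x x * `|y| ^+ 2) -> Gamma x = B x x *: x.
Proof.
move=> linM GM Mx x1 maxx; pose m := B x x; pose Q y z := m * dot y z - B y z.
have QF : symmetric_bilinear Q.
  split=> [y z|y z t|a y z]; rewrite /Q.
  - by rewrite (formC dotF) (formC BF).
  - by rewrite (formDl dotF) (formDl BF); ring.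
  - by rewrite (formZl dotF) (formZl BF); ring.
have Q0 y : M y -> 0 <= Q y y by move=> /maxx; rewrite /Q (dot_sqr dotP) subr_ge0.
apply/eqP; rewrite -subr_eq0; apply/eqP/(dot_eq0 dotP).
set z := _ - _.
have Mz : M z by rewrite /z addrC -scaleNr; apply: linM => //; exact: GM.
have := form_cauchy_schwarz QF linM Q0 Mx Mz.
rewrite {2}/Q (dot_sqr dotP) x1 expr1n mulr1 subrr mul0r exprn_even_le0//= /Q.
by rewrite -GammaB -(formZl dotF) -(formBl dotF) -/m -opprB (formNl dotF) oppr_eq0 => /eqP.
Qed.

Lemma orthogonal_closed (I : Type) (P : set I) (e : I -> H) :
  closed [set x | forall i, P i -> dot x (e i) = 0].
Proof.
rewrite (_ : mkset _ = \bigcap_(i in P) (dot^~ (e i) @^-1` [set 0])).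
  apply: closed_bigI => i _; apply: closed_comp; last exact: closed_eq.
  by move=> x _; exact: dot_continuous.
by apply/seteqP; split=> x.
Qed.

Section ordered_spectrum.
Context (lam : nat -> R) (e : nat -> H).
Hypotheses (lamN : nonincreasing_seq lam) (oe : orthonormal dot e).
Hypothesis Gammae : forall k, Gamma (e k) = lam k *: e k.
Hypothesis eigen_span : forall c w, c != 0 -> Gamma w = c *: w ->
  exists N, w = \sum_(k < N | lam k == c) dot w (e k) *: e k.

Lemma eigenvalue_form k : lam k = B (e k) (e k).
Proof. by rewrite -GammaB Gammae (formZl dotF) oe eqxx mulr1. Qed.

Lemma eigenvalue_ge0 k : 0 <= lam k.
Proof. by rewrite eigenvalue_form. Qed.

Lemma form_eigenvector x k : B x (e k) = lam k * dot x (e k).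
Proof. by rewrite (formC BF) -GammaB Gammae (formZl dotF) (formC dotF). Qed.

Lemma form_le_eigenvalue p r : (forall k, (k < p)%N -> dot r (e k) = 0) ->
  B r r <= lam p * `|r| ^+ 2.
Proof.
move=> re; rewrite leNgt; apply/negP => rB.
pose M := [set x | forall k, (k < p)%N -> dot x (e k) = 0].
have linM : linear_set M.
  by move=> a x y Mx My k kp; rewrite (formDl dotF) (formZl dotF) Mx// My// mulr0 addr0.
have clM : closed M := @orthogonal_closed nat [set k | (k < p)%N] e.
have [|x [Mx x1 lamx maxx]] :=
  form_max_attained dotP cH BF B0 trB linM clM (eigenvalue_ge0 p).
  by exists r.
have Gx : Gamma x = B x x *: x.
  apply: (form_max_eigenvector linM) => // y My k kp.
  by rewrite GammaB form_eigenvector My// mulr0.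
(* The eigenvalue of [x] is nonzero, since it exceeds [lam p >= 0]. Each [e k] with this eigenvalue
   has [k < p] by monotonicity, hence is orthogonal to [x]; thus the expansion of [x] is zero. *)
have [|N xE] := eigen_span _ Gx; first by rewrite gt_eqF// (le_lt_trans (eigenvalue_ge0 p)).
have : `|x| = 0.
  rewrite xE big1 ?normr0// => k /eqP lamk; rewrite Mx ?scale0r//.
  by rewrite ltnNge; apply/negP => /lamN; rewrite lamk leNgt lamx.
by rewrite x1 => /eqP; rewrite oner_eq0.
Qed.

(* Each s_i splits into its components on e_0, ..., e_(p-1), whose squares sum to
   at most 1 for each e_k, and a remainder on which the form is at most lam p. *)
Lemma ky_fan p d (s : nat -> H) : (d <= p)%N -> orthonormal dot (fun i : 'I_d => s i) ->
  \sum_(i < d) B (s i) (s i) <= \sum_(k < p) lam k.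
Proof.
move=> dp os.
have oep : orthonormal dot (fun k : 'I_p => e k) by move=> i j; exact: oe.
have sB i : B (s i) (s i) <=
    \sum_(k < p) (lam k - lam p) * dot (s i) (e k) ^+ 2 + lam p * `|s i| ^+ 2.
  set x := s i; pose w := \sum_(k < p) dot x (e k) *: e k.
  have xe k : (k < p)%N -> dot (x - w) (e k) = 0.
    by move=> kp; exact: (dot_projection dotP oep x (Ordinal kp)).
  have := form_le_eigenvalue xe.
  have -> : `|x - w| ^+ 2 = `|x| ^+ 2 - \sum_(k < p) dot x (e k) ^+ 2.
    rewrite distrC (dist_sum_orthonormal dotP oep) [X in _ + X]big1 ?addr0// => k _.
    by rewrite subrr expr0n.
  have wE y : B y w = \sum_(k < p) lam k * dot x (e k) * dot y (e k).
    rewrite (form_sumr BF); apply: eq_bigr => k _.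
    by rewrite (formZr BF) form_eigenvector; ring.
  (* Both [B x w] and [B w w] equal [\sum_k lam k * dot x (e k) ^+ 2], the [e k] being
     eigenvectors. *)
  have -> : B (x - w) (x - w) = B x x - \sum_(k < p) lam k * dot x (e k) ^+ 2.
    rewrite (form_sqrB BF) !wE.
    rewrite (eq_bigr (fun k : 'I_p => lam k * dot x (e k) ^+ 2)) => [|k _]; last by ring.
    rewrite [X in _ + X](eq_bigr (fun k : 'I_p => lam k * dot x (e k) ^+ 2)) => [|k _].
      by ring.
    by rewrite (dot_sum_orthonormal dotP oep); ring.
  rewrite [X in _ -> _ <= X + _](eq_bigr (fun k : 'I_p =>
      lam k * dot x (e k) ^+ 2 - lam p * dot x (e k) ^+ 2)).
    by rewrite sumrB -mulr_sumr; lra.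
  by move=> k _; rewrite mulrBl.
apply: le_trans (ler_sum _ (fun (i : 'I_d) _ => sB i)) _.
rewrite big_split/= exchange_big/=.
have s1 (i : 'I_d) : lam p * `|s i| ^+ 2 = lam p.
  by rewrite -(dot_sqr dotP) (os i i) eqxx mulr1.
under [X in _ + X]eq_bigr do rewrite s1.
(* The weights [lam k - lam p] are nonnegative and multiply sums at most 1, by Bessel for [e k] on
   the family [s]; the other sum grows from [d] to [p] terms because [lam p >= 0]. *)
apply: (@le_trans _ _ (\sum_(k < p) (lam k - lam p) + \sum_(k < p) lam p)).
  apply: lerD.
    apply: ler_sum => k _; rewrite -mulr_sumr ler_piMr//.
      by rewrite subr_ge0 lamN// ltnW.
    rewrite (eq_bigr (fun i : 'I_d => dot (e k) (s i) ^+ 2)) => [|i _].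
      by have := bessel dotP os (e k); rewrite -(dot_sqr dotP) oe eqxx.
    by rewrite (formC dotF).
  by rewrite !sumr_const !card_ord ler_wpMn2l// eigenvalue_ge0.
by rewrite -big_split/=; apply: ler_sum => k _; rewrite subrK.
Qed.

End ordered_spectrum.
End spectrum.

(** * Completeness of L2 *)

(** The tail bound is explicit because it is applied pointwise, with [C] depending on the point, and
    then integrated. *)
Lemma cvg_of_geometric_increments (R : realType) (a : nat -> R) C :
  (forall k, `|a k.+1 - a k| <= C * 2^-1 ^+ k) ->
  cvgn a /\ forall k, `|limn a - a k| <= 2 * C * 2^-1 ^+ k.
Proof.
move=> aC.
have C0 : 0 <= C by have := aC 0; rewrite expr0 mulr1; exact: le_trans.
have bnd k n : `|a (k + n)%N - a k| <= 2 * C * 2^-1 ^+ k.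
  (* The subtracted term is the exact geometric remainder, which lets the induction on [n] close. *)
  have : `|a (k + n)%N - a k| <= 2 * C * (2^-1 ^+ k - 2^-1 ^+ (k + n)).
    elim: n => [|n IH]; first by rewrite addn0 !subrr normr0 mulr0.
    rewrite addnS -(subrKA (a (k + n)%N)) (le_trans (ler_normD _ _))//.
    have := aC (k + n)%N; move: IH; rewrite exprS.
    by move: (`|_|) (`|_|) (2^-1 ^+ _) (2^-1 ^+ _) => *; nra.
  move=> /le_trans; apply; rewrite ler_wpM2l ?mulr_ge0// gerBl.
  by rewrite exprn_ge0 ?invr_ge0.
have h0 : (fun k => 2 * C * 2^-1 ^+ k) @ \oo --> 0.
  by apply: cvg_geometric; rewrite ger0_norm ?invr_ge0// invf_lt1// ltr1n.
have ca : cvgn a.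
  apply/cauchy_cvgP/cauchy_normP => e e0.
  have e2 : 0 < e / 2 by rewrite divr_gt0.
  have [N _ NP] := @cvgr_le _ _ _ _ _ _ h0 _ e2.
  exists N => n m Nn Nm; rewrite -(subrKA (a N)) (le_trans (ler_normD _ _))//.
  have := bnd N (n - N)%N; have := bnd N (m - N)%N; rewrite !subnKC// (distrC (a m)).
  by have := NP N (leqnn N) => /=; lra.
split=> // k; have : (fun n => `|a n - a k|) @ \oo --> `|limn a - a k|.
  by apply: cvg_norm; apply: cvgB => //; exact: cvg_cst.
move=> h; apply: (ler_cvg_to h (cvg_cst _)); exists k => // n /= kn.
by have := bnd k (n - k)%N; rewrite subnKC.
Qed.

Lemma geometric_subsequence (R : realType) (V : normedModType R) (u : nat -> V) :
  cauchy (u @ \oo) ->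
  exists N : nat -> nat, forall k, `|u (N k.+1) - u (N k)| <= 4^-1 ^+ k /\
    forall n, (N k <= n)%N -> `|u n - u (N k)| <= 4^-1 ^+ k.
Proof.
move=> /cauchy_ballP cu.
have MP k : exists M, forall n m, (M <= n)%N -> (M <= m)%N -> `|u n - u m| <= 4^-1 ^+ k.
  have [|[A B] /= [[n1 _ nA] [n2 _ nB]] AB] := cu (4^-1 ^+ k : R).
    by rewrite exprn_gt0// invr_gt0.
  exists (maxn n1 n2) => n m; rewrite !geq_max => /andP[n1n _] /andP[_ n2m].
  by have := AB (u n, u m) (conj (nA _ n1n) (nB _ n2m)); rewrite /= -ball_normE => /ltW.
have [M {}MP] := choice MP.
(* Partial sums make [N] nondecreasing with [M k <= N k]. *)
pose N k := (\sum_(i < k.+1) M i)%N.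
have MN k : (M k <= N k)%N by rewrite /N big_ord_recr leq_addl.
exists N => k; split=> [|n Nn]; last by apply: MP; rewrite // (leq_trans _ Nn).
by apply: MP => //; rewrite (leq_trans (MN k))// /N [leqRHS]big_ord_recr leq_addr.
Qed.

Section L2.
Context d (T : measurableType d) (R : realType) (mu : {measure set T -> \bar R}).
Local Notation H := (LspaceType2 mu).
Local Notation fn := (@Lspace_fun _ _ _ mu _ (lee1n 2)).

Lemma Lfun2P (f : T -> R) : measurable_fun setT f ->
  (\int[mu]_x (f x ^+ 2)%:E < +oo)%E -> f \in Lfun mu 2%:E.
Proof.
move=> mf fi; rewrite inE; apply/andP; split; rewrite inE//= /finite_norm unlock.
apply: poweR_lty; apply: le_lt_trans fi; rewrite le_eqVlt; apply/orP; left; apply/eqP.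
by apply: eq_integral => x _; rewrite /= powR_mulrn// real_normK ?num_real.
Qed.

Lemma L2_norm_sqr (f : H) : (`|f| ^+ 2)%:E = (\int[mu]_x (fn f x ^+ 2)%:E)%E.
Proof.
have -> : (\int[mu]_x (fn f x ^+ 2)%:E = 'N[mu]_2%:E[EFin \o fn f] `^ 2)%E.
  rewrite poweR_Lnorm ?pnatr_eq0//; apply: eq_integral => x _.
  by rewrite /= powR_mulrn// real_normK ?num_real.
have : finite_norm mu 2%:E (fn f).
  by have := Lspace_fun_Lfun f; rewrite inE => /andP[_]; rewrite inE.
rewrite /finite_norm => fi; rewrite -[X in _ = (X `^ _)%E]fineK; last first.
  by rewrite ge0_fin_numE// Lnorm_ge0.
by rewrite poweR_EFin powR_mulrn// fine_ge0// Lnorm_ge0.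
Qed.

Lemma L2_mul_integrable (f g : H) : mu.-integrable setT (EFin \o (fun x => fn f x * fn g x)).
Proof. exact/Lfun1_integrable/Lfun2_mul_Lfun1/Lspace_fun_Lfun/Lspace_fun_Lfun. Qed.

Lemma eq_ae_l2dot (f g f' g' : T -> R) :
  measurable_fun setT f -> measurable_fun setT g ->
  measurable_fun setT f' -> measurable_fun setT g' ->
  (\forall x \ae mu, f x = f' x) -> (\forall x \ae mu, g x = g' x) ->
  \int[mu]_x (f x * g x) = \int[mu]_x (f' x * g' x).
Proof.
move=> mf mg mf' mg' ff' gg'; congr fine; apply: ae_eq_integral => //.
- exact/measurable_EFinP/measurable_funM.
- exact/measurable_EFinP/measurable_funM.
- by move: ff' gg'; apply: filterS2 => x -> -> _.
Qed.

Lemma l2dot_inner_product : inner_product (@l2dot _ T R mu).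
Proof.
split; first split.
- by move=> f g; apply: eq_Rintegral => x _; rewrite mulrC.
- move=> f g h; rewrite -RintegralD//; [|exact: L2_mul_integrable..].
  under [RHS]eq_Rintegral do rewrite -mulrDl.
  apply: (@eq_ae_l2dot _ (fn h) _ (fn h)) => //;
    [exact: Lspace_fun_measurable..| |exact: Lspace_fun_measurable| |exact: aeW].
    by apply: measurable_funD; exact: Lspace_fun_measurable.
  exact: Lspace_addE.
- move=> a f g; rewrite -RintegralZl//; last exact: L2_mul_integrable.
  under [RHS]eq_Rintegral do rewrite mulrA.
  apply: (@eq_ae_l2dot _ (fn g) _ (fn g)) => //;
    [exact: Lspace_fun_measurable..| |exact: Lspace_fun_measurable| |exact: aeW].
    by apply: measurable_funM => //; exact: Lspace_fun_measurable.
  exact: Lspace_scaleE.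
- move=> f; rewrite -[RHS]/(fine (_%:E)) L2_norm_sqr; congr fine.
Qed.

Lemma L2_class_ex (g : T -> R) : measurable_fun setT g ->
  (\int[mu]_x (g x ^+ 2)%:E < +oo)%E -> exists l : H, \forall x \ae mu, fn l x = g x.
Proof.
move=> mg gi; exists (Lspace_class _ (Lfun2P mg gi)).
by have := Lspace_classE (lee1n 2) (Lfun2P mg gi); apply: filterS => x /(_ I).
Qed.

Lemma L2_dist_sqr (f g : H) : (`|f - g| ^+ 2)%:E = (\int[mu]_x ((fn f x - fn g x) ^+ 2)%:E)%E.
Proof.
rewrite L2_norm_sqr; apply: ae_eq_integral => //.
- by apply/measurable_EFinP/measurable_funX; exact: Lspace_fun_measurable.
- apply/measurable_EFinP/measurable_funX.
  by apply: measurable_funB; exact: Lspace_fun_measurable.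
- have : (\forall x \ae mu, fn (f - g) x = fn f x + fn (- g) x) by exact: Lspace_addE.
  have : (\forall x \ae mu, fn (- g) x = - fn g x) by exact: Lspace_oppE.
  by apply: filterS2 => x gE -> _; rewrite gE.
Qed.

(* With increments of norm at most 4^-k, the function h := sum_k 4^k D_k^2 is
   integrable, and |D_k| <= sqrt h 2^-k wherever h is finite. *)
Lemma L2_complete : seq_complete H.
Proof.
move=> u cu; have half_sqr : (2^-1 : R) ^+ 2 = 4^-1 by field.
have [N NP] := geometric_subsequence cu.
pose v k := u (N k); pose D k x := fn (v k.+1) x - fn (v k) x.
have mfn (f : H) : measurable_fun setT (fn f) by exact: Lspace_fun_measurable.
have mD k : measurable_fun setT (D k) by exact: measurable_funB.
pose g k x := (4 ^+ k * D k x ^+ 2)%:E.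
have mg k : measurable_fun setT (g k).
  by apply/measurable_EFinP/measurable_funM => //; exact: measurable_funX.
have g0 k x : (0 <= g k x)%E by rewrite lee_fin mulr_ge0 ?sqr_ge0// exprn_ge0.
pose h x := (\sum_(0 <= k <oo) g k x)%E.
have h0 x : (0 <= h x)%E by exact: nneseries_ge0.
have mh : measurable_fun setT h by exact: ge0_emeasurable_sum.
have ih : (\int[mu]_x h x < +oo)%E.
  rewrite integral_nneseries//.
  have gk k : (\int[mu]_x g k x <= (4^-1 ^+ k)%:E)%E.
    rewrite /g; under eq_integral do rewrite EFinM.
    rewrite ge0_integralZl_EFin ?exprn_ge0//; last 2 first.
    - by move=> x _; rewrite lee_fin sqr_ge0.
    - by apply/measurable_EFinP; exact: measurable_funX.
    rewrite -L2_dist_sqr -EFinM lee_fin.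
    have [vk _] := NP k.
    rewrite (@le_trans _ _ (4 ^+ k * (4^-1 ^+ k) ^+ 2))//.
      by rewrite ler_wpM2l ?exprn_ge0// ler_sqr ?nnegrE// exprn_ge0 ?invr_ge0.
    by rewrite expr2 mulrA -exprMn divff ?expr1n ?mul1r.
  apply: (@le_lt_trans _ _ (\sum_(0 <= k <oo) (4^-1 ^+ k)%:E)%E).
    by apply: lee_nneseries => [k _ _|k _]; [exact: integral_ge0|exact: gk].
  apply: (@le_lt_trans _ _ 2%:E); last exact: ltry.
  apply: lime_le; first by apply: is_cvg_nneseries => k _ _; rewrite lee_fin exprn_ge0 ?invr_ge0.
  apply: nearW => n; rewrite sumEFin lee_fin.
  have : \sum_(0 <= k < n) (4^-1 ^+ k : R) <= 2 - 2 * 4^-1 ^+ n.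
    elim: n => [|n IH]; first by rewrite big_geq// expr0; lra.
    have : 0 <= (4^-1 : R) ^+ n by rewrite exprn_ge0 ?invr_ge0.
    by rewrite big_nat_recr//= exprS; move: IH; lra.
  by move=> /le_trans; apply; rewrite gerBl mulr_ge0// exprn_ge0 ?invr_ge0.
pose A := [set x | h x \is a fin_num].
have mA : measurable A by rewrite -[A]setTI; exact: emeasurable_fin_num.
have aeA : \forall x \ae mu, A x.
  have /integrable_ae : mu.-integrable setT h.
    by apply/integrableP; split=> //; under eq_integral do rewrite gee0_abs//.
  by move=> /(_ measurableT); apply: filterS => x /(_ I).
(* Cutting off outside [A], whose complement is negligible, makes the limit exist at every point and
   hence be measurable. *)
pose F k x := fn (v k) x * \1_A x; pose C x := Num.sqrt (fine (h x)) * \1_A x.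
have FC x k : `|F k.+1 x - F k x| <= C x * 2^-1 ^+ k.
  rewrite -mulrBl -/(D k x) /C indicE.
  have [/set_mem Ax|_] := boolP (x \in A); last by rewrite !mulr0 mul0r normr0.
  rewrite !mulr1 -ler_sqr ?nnegrE//.
  rewrite exprMn sqr_sqrtr ?fine_ge0// real_normK ?num_real//.
  have : (g k x <= h x)%E.
    have := @nneseries_lim_ge R (g^~ x) predT 0 k.+1 (fun n _ _ => g0 n x).
    apply: le_trans; rewrite big_nat_recr//= leeDr//.
    by apply: sume_ge0 => i _; exact: g0.
  rewrite -[h x]fineK// lee_fin => gh.
  rewrite exprAC half_sqr exprVn ler_pdivlMr ?exprn_gt0// mulrC.
  exact: gh.
pose L x := limn (F^~ x).
have LP x : F^~ x @ \oo --> L x /\ forall k, `|L x - F k x| <= 2 * C x * 2^-1 ^+ k.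
  by have [] := cvg_of_geometric_increments (FC x).
have mF k : measurable_fun setT (F k).
  by apply: measurable_funM => //; exact: measurable_indic.
have mL : measurable_fun setT L.
  by apply: (measurable_fun_cvg mF) => x _; have [] := LP x.
have LF k : (\int[mu]_x ((L x - F k x) ^+ 2)%:E <= (4 * 4^-1 ^+ k)%:E * \int[mu]_x h x)%E.
  rewrite -ge0_integralZl_EFin ?mulr_ge0 ?exprn_ge0 ?invr_ge0//.
  apply: ge0_le_integral => //.
  - by move=> x _; rewrite lee_fin sqr_ge0.
  - by apply/measurable_EFinP/measurable_funX; exact: measurable_funB.
  - by apply: emeasurable_funM => //.
  move=> x _; have [_ /(_ k)] := LP x; rewrite /C.
  have [Ax|nAx] := pselect (A x); last first.
    rewrite indicE memNset// mulr0 mulr0 mul0r normr_le0 => /eqP ->.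
    by rewrite expr0n mule_ge0// lee_fin mulr_ge0// exprn_ge0 ?invr_ge0.
  rewrite indicE mem_set// mulr1 -[h x]fineK// -EFinM lee_fin => LFk.
  rewrite -[leLHS]real_normK ?num_real//.
  apply: (@le_trans _ _ ((2 * Num.sqrt (fine (h x)) * 2^-1 ^+ k) ^+ 2)).
    by rewrite ler_sqr ?nnegrE// (le_trans _ LFk).
  rewrite !exprMn sqr_sqrtr ?fine_ge0// exprAC half_sqr.
  by rewrite [2 ^+ 2](_ : _ = 4) 1?mulrAC//; ring.
have vF k : \forall x \ae mu, F k x = fn (v k) x.
  by apply: filterS aeA => x Ax; rewrite /F indicE mem_set// mulr1.
(* Square integrability is known for the difference [L - F 0]; the class of [L] is then recovered by
   adding [v 0] back. *)
have [w wE] : exists w : H, \forall x \ae mu, fn w x = L x - F 0%N x.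
  apply: L2_class_ex; first exact: measurable_funB.
  by apply: le_lt_trans (LF 0%N) _; rewrite lte_mul_pinfty// lee_fin mulr_ge0.
pose l := w + v 0%N.
have lE : \forall x \ae mu, fn l x = L x.
  have : (\forall x \ae mu, fn (w + v 0%N) x = fn w x + fn (v 0%N) x) by exact: Lspace_addE.
  move: wE (vF 0%N); apply: filterS3 => x wx vx ->.
  by rewrite wx vx subrK.
have lv k : `|l - v k| ^+ 2 <= 4 * 4^-1 ^+ k * fine (\int[mu]_x h x).
  rewrite -lee_fin L2_dist_sqr EFinM fineK ?ge0_fin_numE ?integral_ge0//.
  rewrite (le_trans _ (LF k))// le_eqVlt; apply/orP; left; apply/eqP.
  apply: ae_eq_integral => //.
  - by apply/measurable_EFinP/measurable_funX; exact: measurable_funB.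
  - by apply/measurable_EFinP/measurable_funX; exact: measurable_funB.
  - by move: lE (vF k); apply: filterS2 => x -> -> _.
have vl : v @ \oo --> l.
  apply/cvgrPdist_le => e e0; have e2 : 0 < e ^+ 2 by rewrite exprn_gt0.
  have : (fun k => 4 * 4^-1 ^+ k * fine (\int[mu]_x h x)) @ \oo --> 0.
    rewrite -(mul0r (fine (\int[mu]_x h x))); apply: cvgMl.
    by apply: cvg_geometric; rewrite ger0_norm ?invr_ge0// invf_lt1// ltr1n.
  move=> /cvgr_le/(_ _ e2); apply: filterS => k ke.
  by rewrite -ler_sqr ?nnegrE ?(ltW e0)// (le_trans (lv k)).
exists l; apply/cvgrPdist_le => e e0; have e2 : 0 < e / 2 by rewrite divr_gt0.
have : (fun k => 4^-1 ^+ k : R) @ \oo --> 0.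
  by apply: cvg_expr; rewrite ger0_norm ?invr_ge0// invf_lt1// ltr1n.
move=> /cvgr_le/(_ _ e2) hk; move/cvgrPdist_le : vl => /(_ _ e2) hv.
(* Past [N k] the sequence [u] stays within [4^-1 ^+ k] of [v k], so the limit of the subsequence is
   that of [u]. *)
have [k [ke vk]] : exists k, 4^-1 ^+ k <= e / 2 /\ `|l - v k| <= e / 2.
  by apply: (@filter_ex _ (nbhs \oo)); exact: filterI.
have [_ uk] := NP k; exists (N k) => // n /= /uk un.
rewrite -(subrKA (v k)) (le_trans (ler_normD _ _))// (splitr e) lerD//.
by rewrite distrC (le_trans un).
Qed.

End L2.

(** * Mean and covariance of a measure with finite second moment *)

Lemma continuous_measurable_borel (R : realType) (S : ptopologicalType) (f : S -> R) :
  continuous f -> measurable_fun [set: borel S] (f : borel S -> R).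
Proof.
move=> cf; apply: (@measurability _ _ _ _ _ _ (@RGenOInfty.G R)).
  exact: RGenOInfty.measurableE.
move=> _ [_ [x ->] <-]; rewrite setTI; apply: sub_sigma_algebra.
by move/continuousP : cf; apply; exact: interval_open.
Qed.

Lemma continuous_borel_measurable (S S' : ptopologicalType) (f : S -> S') :
  continuous f -> measurable_fun [set: borel S] (f : borel S -> borel S').
Proof.
move=> cf; apply: (@measurability _ _ _ (borel S') _ _ (@open S')) => //.
move=> _ [A oA <-]; rewrite setTI; apply: sub_sigma_algebra.
by move/continuousP : cf; exact.
Qed.

(** Both integrals are suprema over the simple functions below the integrand, so monotonicity holds
    for arbitrary nonnegative functions, among them errors with arbitrary coefficients. *)
Lemma ge0_le_integralT d (T : measurableType d) (R : realType)
    (mu : {measure set T -> \bar R}) (f g : T -> \bar R) :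
  (forall x, (0 <= f x)%E) -> (forall x, (f x <= g x)%E) ->
  (\int[mu]_x f x <= \int[mu]_x g x)%E.
Proof.
move=> f0 fg; rewrite !ge0_integralTE//; last by move=> x; exact: le_trans (fg x).
apply: ereal_sup_le => _ [h hf <-]; exists h => // x.
exact: le_trans (hf x) (fg x).
Qed.

Lemma EFin_Rintegral d (T : measurableType d) (R : realType)
    (mu : {measure set T -> \bar R}) (f : T -> R) :
  mu.-integrable setT (EFin \o f) -> (\int[mu]_x (f x)%:E = (\int[mu]_x f x)%:E)%E.
Proof. by move=> fi; rewrite /Rintegral fineK//; exact: integrable_fin_num. Qed.

Section EFin_integrable.
Context d (T : measurableType d) (R : realType) (mu : {measure set T -> \bar R}).
Implicit Types f g : T -> R.

Lemma EFin_integrableZl a f : mu.-integrable setT (EFin \o f) ->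
  mu.-integrable setT (EFin \o (fun x => a * f x)).
Proof. exact: integrableZl. Qed.

Lemma EFin_integrableD f g : mu.-integrable setT (EFin \o f) ->
  mu.-integrable setT (EFin \o g) -> mu.-integrable setT (EFin \o (fun x => f x + g x)).
Proof. exact: integrableD. Qed.

Lemma EFin_integrableB f g : mu.-integrable setT (EFin \o f) ->
  mu.-integrable setT (EFin \o g) -> mu.-integrable setT (EFin \o (fun x => f x - g x)).
Proof. exact: integrableB. Qed.

Lemma EFin_integrable_sum (I : finType) (h : I -> T -> R) :
  (forall i, mu.-integrable setT (EFin \o h i)) ->
  mu.-integrable setT (EFin \o (fun x => \sum_i h i x)).
Proof.
move=> ih; rewrite (_ : _ \o _ = fun x => (\sum_i (EFin \o h i) x)%E).
  by apply: integrable_sum.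
by apply/funext => x /=; rewrite sumEFin.
Qed.

Lemma Rintegral_fsum (I : finType) (h : I -> T -> R) :
  (forall i, mu.-integrable setT (EFin \o h i)) ->
  \int[mu]_x (\sum_i h i x) = \sum_i \int[mu]_x h i x.
Proof.
move=> ih; apply: EFin_inj; rewrite -EFin_Rintegral; last exact: EFin_integrable_sum.
under eq_integral do rewrite -sumEFin.
rewrite integral_sum// -sumEFin; apply: eq_bigr => i _; exact: EFin_Rintegral.
Qed.

End EFin_integrable.

Section second_moment.
Context (R : realType) (H : normedModType R) (dot : H -> H -> R).
Hypotheses (dotP : inner_product dot) (cH : seq_complete H).
Let dotF : symmetric_bilinear dot := dotP.
Context (nu : probability (borel H) R).
Hypothesis nu2 : (\int[nu]_v (`|v : H| ^+ 2)%:E < +oo)%E.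

Lemma norm_sqr_continuous : continuous (fun v : H => `|v| ^+ 2).
Proof.
move=> v; under [X in continuous_at _ X]eq_fun do rewrite expr2.
by apply: cvgM; exact: norm_continuous.
Qed.

Lemma moment_integrable : nu.-integrable [set: borel H]
  (EFin \o (fun v : H => 1 + `|v| ^+ 2)).
Proof.
apply: EFin_integrableD; first exact: finite_measure_integrable_cst.
apply/integrableP; split.
  apply/measurable_EFinP; apply: continuous_measurable_borel.
  exact: norm_sqr_continuous.
by under eq_integral do rewrite gee0_abs ?lee_fin ?sqr_ge0//.
Qed.

Lemma quadratic_growth_integrable (f : H -> R) C : continuous f ->
  (forall v, `|f v| <= C * (1 + `|v| ^+ 2)) ->
  nu.-integrable [set: borel H] (EFin \o f).
Proof.
move=> cf fC; apply: (@le_integrable _ _ _ nu _ measurableT _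
    (EFin \o (fun v : H => C * (1 + `|v| ^+ 2)))).
- by apply/measurable_EFinP; exact: continuous_measurable_borel.
- by move=> v _ /=; rewrite lee_fin (le_trans (fC v))// ler_norm.
by apply: EFin_integrableZl; exact: moment_integrable.
Qed.

Lemma norm_quadratic_growth (v : H) : `|v| <= 1 + `|v| ^+ 2.
Proof. by have := sqr_ge0 (`|v| - 1); have := normr_ge0 v; nra. Qed.

Lemma dot_integrable w : nu.-integrable [set: borel H] (EFin \o (fun v : H => dot v w)).
Proof.
apply: (@quadratic_growth_integrable _ `|w|); first exact: dot_continuous.
move=> v; rewrite (le_trans (dot_le dotP _ _))// mulrC ler_wpM2l//.
exact: norm_quadratic_growth.
Qed.

(** Riesz representation of [w |-> \int <v, w>], whose boundedness follows from [|v| <= 1 + |v|^2]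
    and the finite second moment. *)
Lemma mean_ex : exists m, forall w, dot m w = \int[nu]_v dot v w.
Proof.
apply: (riesz_representation dotP cH (C := \int[nu]_v (1 + `|v : H| ^+ 2))).
  move=> a x y; rewrite -RintegralZl//; last exact: dot_integrable.
  rewrite -RintegralD//; last 2 first.
  - by apply: EFin_integrableZl; exact: dot_integrable.
  - exact: dot_integrable.
  by apply: eq_Rintegral => v _; rewrite (formDr dotF) (formZr dotF).
move=> x; rewrite (le_trans (le_normr_Rintegral _ (dot_integrable x)))//.
rewrite -RintegralZr//; last exact: moment_integrable.
apply: le_Rintegral => //.
- by apply: integrable_norm; exact: dot_integrable.
- by under eq_fun do rewrite mulrC; apply: EFin_integrableZl; exact: moment_integrable.
move=> v _; rewrite (le_trans (dot_le dotP _ _))// ler_wpM2r//.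
exact: norm_quadratic_growth.
Qed.

Section centered.
Context (m : H).
Hypothesis mE : forall w, dot m w = \int[nu]_v dot v w.

Definition covariance_form w z := \int[nu]_v (dot (v - m) w * dot (v - m) z).
Definition total_variance := \int[nu]_v (`|v - m : H| ^+ 2).
Local Notation B := covariance_form.
Local Notation V := total_variance.

Lemma center_continuous : continuous (fun v : H => v - m).
Proof. by move=> v; apply: cvgB => //; exact: cvg_cst. Qed.

Lemma center_norm_integrable :
  nu.-integrable [set: borel H] (EFin \o (fun v : H => `|v - m| ^+ 2)).
Proof.
apply: (@quadratic_growth_integrable _ (2 + 2 * `|m| ^+ 2)) => [v|v].
  apply: (@continuous_comp _ _ _ (fun v : H => v - m) (fun v : H => `|v| ^+ 2)).
    exact: center_continuous.
  exact: norm_sqr_continuous.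
rewrite ger0_norm ?sqr_ge0//; have := ler_normB v m.
have := normr_ge0 (v - m); have := sqr_ge0 (`|v| - `|m|).
have := mulr_ge0 (sqr_ge0 `|m|) (sqr_ge0 `|v|).
by move: `|v - m| `|v| `|m| => a b c; nra.
Qed.

Lemma center_dot_integrable w :
  nu.-integrable [set: borel H] (EFin \o (fun v : H => dot (v - m) w)).
Proof.
rewrite (_ : (fun v => _) = fun v => dot v w - dot m w).
  apply: EFin_integrableB; first exact: dot_integrable.
  exact: finite_measure_integrable_cst.
by apply/funext => v; rewrite (formBl dotF).
Qed.

Lemma center_dot_mean w : \int[nu]_v dot (v - m) w = 0.
Proof.
under eq_Rintegral do rewrite (formBl dotF).
rewrite RintegralB//; [|exact: dot_integrable|exact: finite_measure_integrable_cst].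
have nuT : nu [set: borel H] = 1%E by exact: probability_setT.
by rewrite -mE Rintegral_cst// [X in _ - _ * X](congr1 fine nuT) mulr1 subrr.
Qed.

Lemma center_dot_continuous w : continuous (fun v : H => dot (v - m) w).
Proof.
move=> v; apply: (@continuous_comp _ _ _ (fun v : H => v - m) (dot^~ w)).
  exact: center_continuous.
exact: dot_continuous.
Qed.

Lemma covariance_integrable w z :
  nu.-integrable [set: borel H] (EFin \o (fun v : H => dot (v - m) w * dot (v - m) z)).
Proof.
apply: (@le_integrable _ _ _ nu _ measurableT _
    (fun v : borel H => (`|w| * `|z|)%:E * (`|(v : H) - m| ^+ 2)%:E)%E).
- apply/measurable_EFinP; apply: (@continuous_measurable_borel _ H) => v.
  by apply: cvgM; exact: center_dot_continuous.
- move=> v _; rewrite -EFinM /= lee_fin normrM [leRHS]ger0_norm ?mulr_ge0//.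
  apply: (@le_trans _ _ ((`|(v : H) - m| * `|w|) * (`|(v : H) - m| * `|z|))).
    by apply: ler_pM => //; exact: dot_le.
  by rewrite expr2 mulrACA mulrC.
apply: integrableZl => //; exact: center_norm_integrable.
Qed.

Lemma covariance_symmetric_bilinear : symmetric_bilinear B.
Proof.
split=> [x y|x y z|a x y].
- by apply: eq_Rintegral => v _; rewrite mulrC.
- rewrite -RintegralD//; [|exact: covariance_integrable..].
  by apply: eq_Rintegral => v _; rewrite (formDr dotF) mulrDl.
- rewrite -RintegralZl//; last exact: covariance_integrable.
  by apply: eq_Rintegral => v _; rewrite (formZr dotF) mulrA.
Qed.

Lemma covariance_ge0 x : 0 <= B x x.
Proof. by apply: Rintegral_ge0 => v _; rewrite -expr2 sqr_ge0. Qed.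

Lemma covariance_sum_integrable (I : finType) (s : I -> H) :
  nu.-integrable [set: borel H] (EFin \o (fun v : H => \sum_i dot (v - m) (s i) ^+ 2)).
Proof.
by apply: EFin_integrable_sum => i; under eq_fun do rewrite expr2; exact: covariance_integrable.
Qed.

Lemma covariance_sum (I : finType) (s : I -> H) :
  \int[nu]_v (\sum_i dot (v - m) (s i) ^+ 2) = \sum_i B (s i) (s i).
Proof. by rewrite Rintegral_fsum// => i; exact: covariance_integrable. Qed.

(** Bessel's inequality for [v - m], integrated; it supplies the trace bound assumed in the study of
    abstract forms. *)
Lemma covariance_trace_le (I : finType) (s : I -> H) : orthonormal dot s ->
  \sum_i B (s i) (s i) <= V.
Proof.
move=> os; rewrite -covariance_sum; apply: le_Rintegral => //.
- exact: covariance_sum_integrable.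
- exact: center_norm_integrable.
by move=> v _; exact: (bessel dotP os).
Qed.

(** Riesz representation of [B w], bounded by [V * |w|] through Cauchy-Schwarz and the trace bound
    on single vectors. *)
Lemma covariance_operator_ex w : exists g, forall z, dot g z = B w z.
Proof.
have BF := covariance_symmetric_bilinear.
have le x : B x x <= V * `|x| ^+ 2.
  by apply: (form_le_trace dotP BF) => d s; exact: covariance_trace_le.
apply: (riesz_representation dotP cH (C := V * `|w|)) => [a x y|x].
  by rewrite (formDr BF) (formZr BF).
have V0 : 0 <= V by apply: Rintegral_ge0 => v _; exact: sqr_ge0.
rewrite -ler_sqr ?nnegrE ?mulr_ge0// real_normK ?num_real//.
have linT : linear_set [set: H] by [].
have := form_cauchy_schwarz BF linT (fun x _ => covariance_ge0 x) (I : setT w) (I : setT x).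
move=> /le_trans; apply.
rewrite [leRHS](_ : _ = (V * `|w| ^+ 2) * (V * `|x| ^+ 2)); last by ring.
by rewrite ler_pM ?covariance_ge0.
Qed.

Lemma residual_integrable (I : finType) (s : I -> H) : nu.-integrable [set: borel H]
  (EFin \o (fun v : H => `|v - m| ^+ 2 - \sum_i dot (v - m) (s i) ^+ 2)).
Proof.
by apply: EFin_integrableB; [exact: center_norm_integrable|exact: covariance_sum_integrable].
Qed.

Lemma residual_integral (I : finType) (s : I -> H) :
  \int[nu]_v (`|v - m| ^+ 2 - \sum_i dot (v - m) (s i) ^+ 2) = V - \sum_i B (s i) (s i).
Proof.
rewrite RintegralB//; [|exact: center_norm_integrable|exact: covariance_sum_integrable].
by rewrite covariance_sum.
Qed.

(* The cross terms between v - m and m - c integrate to 0, so that among the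
   translates of a subspace those through the mean are the closest to nu. *)
Lemma affine_dist_integral_ge p (c : H) (sigma : 'I_p -> H) (a : H -> 'I_p -> R) :
  exists d (s : nat -> H), [/\ (d <= p)%N, orthonormal dot (fun i : 'I_d => s i) &
    ((V - \sum_(i < d) B (s i) (s i))%:E <=
     \int[nu]_v (`|c + \sum_j a v j *: sigma j - v| ^+ 2)%:E)%E].
Proof.
have [d [s [dp os sP]]] := gram_schmidt dotP sigma.
exists d, s; split=> //.
pose b := m - c; pose b' := b - \sum_(i < d) dot b (s i) *: s i.
pose q (v : H) := `|v - c| ^+ 2 - \sum_(i < d) dot (v - c) (s i) ^+ 2.
pose r (v : H) := `|v - m| ^+ 2 - \sum_(i < d) dot (v - m) (s i) ^+ 2.
have ir : nu.-integrable [set: borel H] (EFin \o r) by exact: residual_integrable.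
have ib : nu.-integrable [set: borel H] (EFin \o (fun v : H => 2 * dot (v - m) b')).
  by apply: EFin_integrableZl; exact: center_dot_integrable.
(* [q v] and [r v] are the squared distances from [v] to the translates of the span of [s] through
   [c] and through [m]; [b'] is the part of [m - c] orthogonal to [s], and the constant [q m] equals
   [|b'|^2]. *)
have qE v : q v = r v + 2 * dot (v - m) b' + q m.
  rewrite /q /r (_ : v - c = (v - m) + b); last by rewrite /b subrKA.
  rewrite -/b; set x := v - m; rewrite -!(dot_sqr dotP) (form_sqrD dotF) /b'.
  rewrite (formBr dotF x b) (form_sumr dotF).
  have -> : \sum_(i < d) dot (x + b) (s i) ^+ 2 = \sum_(i < d) dot x (s i) ^+ 2 +
      2 * \sum_(i < d) dot x (dot b (s i) *: s i) + \sum_(i < d) dot b (s i) ^+ 2.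
    rewrite mulr_sumr -!big_split; apply: eq_bigr => i _ /=.
    by rewrite (formDl dotF) (formZr dotF); ring.
  by ring.
have q0 v : 0 <= q v by rewrite subr_ge0; exact: (bessel dotP os).
have iq : nu.-integrable [set: borel H] (EFin \o q).
  rewrite (_ : q = fun v => r v + 2 * dot (v - m) b' + q m); last exact/funext.
  apply: EFin_integrableD; last exact: finite_measure_integrable_cst.
  exact: EFin_integrableD.
apply: (@le_trans _ _ (\int[nu]_v (q v)%:E)%E).
  rewrite EFin_Rintegral// lee_fin.
  have -> : V - \sum_(i < d) B (s i) (s i) = \int[nu]_v (r v + 2 * dot (v - m) b').
    rewrite RintegralD// RintegralZl//; last exact: center_dot_integrable.
    by rewrite center_dot_mean mulr0 addr0 residual_integral.
  apply: le_Rintegral => //; last by move=> v _; rewrite qE lerDl.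
  exact: EFin_integrableD.
apply: ge0_le_integralT => v; first by rewrite lee_fin.
have [t tE] := sP (a v).
rewrite lee_fin (_ : c + _ - v = \sum_j a v j *: sigma j - (v - c)); last first.
  by rewrite opprB addrCA addrA addrC.
rewrite tE (dist_sum_orthonormal dotP os) lerDl.
by apply: sumr_ge0 => i _; exact: sqr_ge0.
Qed.

End centered.
End second_moment.


(** * Optimality of the principal components *)

Lemma row_continuous (R : realType) (S : topologicalType) p (f : 'I_p -> S -> R) :
  (forall j, continuous (f j)) -> continuous (fun v => \row_j f j v).
Proof.
move=> cf v; apply/cvgrPdist_le => e e0.
have h j : \forall w \near v, `|f j v - f j w| <= e.
  by have /cvgrPdist_le := cf j v; apply.
have {h} := filter_forall (nbhs_filter v) h; apply: filterS => w wP.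
rewrite -[leLHS]/(mx_norm _) mx_normrE; apply/bigmax_leP; split; first exact: ltW.
by move=> [i j] _ /=; rewrite !mxE.
Qed.

Section principal_components.
Context d (T : measurableType d) (R : realType) (mu : {measure set T -> \bar R}).
Local Notation H := (LspaceType2 mu).
Let dotP : inner_product (@l2dot _ T R mu) := l2dot_inner_product mu.
Let dotF : symmetric_bilinear (@l2dot _ T R mu) := dotP.
Let cH : seq_complete H := @L2_complete _ T R mu.
Context (nu : probability (borel H) R).
Hypothesis nu2 : (\int[nu]_v (`|v : H| ^+ 2)%:E < +oo)%E.
Local Notation m := (l2mean nu).
Local Notation Gamma := (covariance_op nu).
Local Notation B := (covariance_form (@l2dot _ T R mu) nu m).
Local Notation V := (total_variance nu m).

(** [l2mean] is chosen with default 0; [mean_ex] shows that the choice is made in a nonempty set. *)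
Lemma l2meanP (w : H) : l2dot m w = \int[nu]_v l2dot v w.
Proof.
have [m' m'P] := mean_ex dotP cH nu2.
have h : exists m0 : H, forall w,
    nu.-integrable [set: borel H] (fun v : borel H => (l2dot (id v) w)%:E) /\
    l2dot m0 w = \int[nu]_v l2dot (id v) w.
  by exists m' => z; split; [exact: (dot_integrable dotP nu2)|exact: m'P].
by have [] := xgetPex 0 h w.
Qed.

Lemma covariance_opP (w z : H) : l2dot (Gamma w) z = B w z.
Proof.
have [g gP] := covariance_operator_ex dotP cH nu2 m w.
have tE (v z' : H) : l2dot (l2tensor (v - m) (v - m) w) z' = l2dot (v - m) w * l2dot (v - m) z'.
  by rewrite (formZl dotF).
have h : exists g0 : H, forall z', nu.-integrable [set: borel H]
      (fun v : borel H => (l2dot (l2tensor ((v : H) - m) ((v : H) - m) w) z')%:E) /\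
    l2dot g0 z' = \int[nu]_v l2dot (l2tensor ((v : H) - m) ((v : H) - m) w) z'.
  exists g => z'; split; last by rewrite gP; apply: eq_Rintegral => v _; rewrite tE.
  by under eq_fun do rewrite tE; exact: (covariance_integrable dotP nu2).
have [_ ->] := xgetPex 0 h z.
by apply: eq_Rintegral => v _; rewrite tE.
Qed.

Section optimality.
Context (p : nat) (lam : nat -> R) (tau : 'I_p -> H).
Hypotheses (specG : ordered_spectrum Gamma lam) (otau : l2orthonormal tau).
Hypothesis Gtau : forall j, Gamma (tau j) = lam j *: tau j.
Local Notation Ropt := (affine_reconstruction m tau).
Local Notation Popt := (affine_projection m tau).

(** The squared distance from [v] to the range of [Ropt]. *)
Let r (v : H) := `|v - m| ^+ 2 - \sum_j l2dot (v - m) (tau j) ^+ 2.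

Lemma affine_projection_continuous : continuous (Popt : H -> 'rV[R]_p).
Proof.
by apply: row_continuous => j; exact: center_dot_continuous.
Qed.

Lemma affine_projection_affine : affine_map (Popt : H -> 'rV[R]_p).
Proof.
move=> t v w; apply/rowP => j; rewrite !mxE -!(formZl dotF) -(formDl dotF).
congr l2dot; rewrite !scalerBr addrACA -opprD -scalerDl subrKC scale1r//.
Qed.

Lemma reconstruction_dist (a : 'rV[R]_p) (v : H) :
  `|Ropt a - v| ^+ 2 = r v + \sum_j (a ord0 j - Popt v ord0 j) ^+ 2.
Proof.
rewrite (_ : Ropt a - v = \sum_j a ord0 j *: tau j - (v - m)); last first.
  by rewrite /affine_reconstruction opprB addrCA addrA addrC.
rewrite (dist_sum_orthonormal dotP otau); congr (_ + _).
by apply: eq_bigr => j _; rewrite mxE.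
Qed.

Lemma residual_ge0 v : 0 <= r v.
Proof. by rewrite subr_ge0; exact: (bessel dotP otau). Qed.

(** [Popt] supplies the Fourier coefficients, so what remains is the integral of [r], and the
    variance captured along [tau j] is [lam j]. *)
Lemma optimal_error_integral :
  (\int[nu]_v (`|Ropt (Popt v) - v| ^+ 2)%:E = (V - \sum_(k < p) lam k)%:E)%E.
Proof.
have -> : \sum_(k < p) lam k = \sum_j B (tau j) (tau j).
  apply: eq_bigr => j _; rewrite -covariance_opP Gtau (formZl dotF).
  by rewrite (otau j j) eqxx mulr1.
rewrite -(residual_integral dotP nu2) -EFin_Rintegral; last exact: (residual_integrable dotP nu2).
apply: eq_integral => v _; rewrite reconstruction_dist big1 ?addr0// => j _.
by rewrite subrr expr0n.
Qed.

Lemma optimal_error_le (sigma0 : H) (sigma : 'I_p -> H) (P : H -> 'rV[R]_p) :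
  (reconstruction_error nu Ropt Popt
   <= reconstruction_error nu (affine_reconstruction sigma0 sigma) P)%E.
Proof.
have [lamN [e [oe Ge Gspan]]] := specG.
rewrite lee_sqrt; last by apply: integral_ge0 => v _; rewrite lee_fin sqr_ge0.
rewrite optimal_error_integral.
have [d' [s [dp os]]] :=
  affine_dist_integral_ge dotP nu2 l2meanP sigma0 sigma (fun v j => P v ord0 j).
apply: le_trans; rewrite lee_fin lerB//.
exact: (ky_fan dotP cH (covariance_symmetric_bilinear dotP nu2 m) (covariance_ge0 _ _ _)
  (fun d (s : nat -> H) => covariance_trace_le dotP nu2 m (s := fun i : 'I_d => s i))
  covariance_opP lamN oe Ge Gspan dp os).
Qed.

(** By the value of the optimal error it suffices to bound every [\sum_(k < n) lam k] by [V]; this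
    sum is the trace of [B] on the first [n] vectors [e k]. *)
Lemma optimal_error_ge :
  (sqrte (\sum_(p <= k <oo) (lam k)%:E) <= reconstruction_error nu Ropt Popt)%E.
Proof.
have [_ [e [oe Ge _]]] := specG.
rewrite lee_sqrt; last by apply: integral_ge0 => v _; rewrite lee_fin sqr_ge0.
rewrite optimal_error_integral.
have lamB k : lam k = B (e k) (e k).
  by rewrite -covariance_opP Ge (formZl dotF) oe eqxx mulr1.
apply: lime_le; first by apply: is_cvg_nneseries => k _ _; rewrite lee_fin lamB covariance_ge0.
exists p => // n /= pn; rewrite sumEFin lee_fin lerBrDl -(big_mkord xpredT) -big_cat_nat//=.
rewrite big_mkord (eq_bigr _ (fun (k : 'I_n) _ => lamB k)).
by apply: (covariance_trace_le dotP nu2) => i j; exact: oe.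
Qed.

(** By Pythagoras the squared error of [P] exceeds that of [Popt] by the integral of [s]; equality
    forces [s] to vanish almost everywhere. *)
Lemma optimal_projection_unique (P : H -> 'rV[R]_p) : measurable_projection P ->
  reconstruction_error nu Ropt P = reconstruction_error nu Ropt Popt ->
  {ae nu, forall v, P v = Popt v}.
Proof.
move=> mP errE.
pose s (v : H) := \sum_j (P v ord0 j - Popt v ord0 j) ^+ 2.
have ms : measurable_fun [set: borel H] (s : borel H -> R).
  apply: (@measurable_sum _ (borel H)) => j; apply: measurable_funX; apply: measurable_funB.
    apply: (@measurableT_comp _ _ _ _ (borel 'rV[R]_p) _
      (fun x : borel 'rV[R]_p => (x : 'rV[R]_p) ord0 j)) => //.
    by apply: continuous_measurable_borel; exact: coord_continuous.
  under eq_fun do rewrite mxE.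
  by apply: continuous_measurable_borel; exact: center_dot_continuous.
have s0 v : 0 <= s v by apply: sumr_ge0 => j _; exact: sqr_ge0.
have mr : measurable_fun [set: borel H] (r : borel H -> R).
  by apply/measurable_EFinP; exact: measurable_int (residual_integrable dotP nu2 m tau).
have sint : (\int[nu]_v (s v)%:E = 0)%E.
  have := errE; rewrite /reconstruction_error => /(congr1 (fun x => x ^+ 2)%E).
  rewrite !sqr_sqrte; [|by apply: integral_ge0 => v _; rewrite lee_fin sqr_ge0..].
  rewrite optimal_error_integral.
  under eq_integral do rewrite reconstruction_dist EFinD.
  rewrite ge0_integralD//; last 4 first.
  - by move=> v _; rewrite lee_fin residual_ge0.
  - exact/measurable_EFinP.
  - by move=> v _; rewrite lee_fin s0.
  - exact/measurable_EFinP.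
  have -> : (\int[nu]_v (r v)%:E = (V - \sum_(k < p) lam k)%:E)%E.
    rewrite -optimal_error_integral; apply: eq_integral => v _.
    by rewrite reconstruction_dist big1 ?addr0// => j _; rewrite subrr expr0n.
  (* The integral of [r] is finite and cancels; an infinite integral of [s] would contradict the
     equation. *)
  case: (\int[nu]_v _)%E => [x| |]//= [] /eqP.
  by rewrite -[eqbRHS]addr0 (inj_eq (addrI _)) => /eqP ->.
have /ae_eq_integral_abs : measurable_fun [set: borel H] (EFin \o s : borel H -> \bar R).
  exact/measurable_EFinP.
move=> /(_ nu measurableT)[+ _].
have -> : (\int[nu]_v `|(EFin \o s) v| = 0)%E.
  by rewrite -sint; apply: eq_integral => v _; rewrite gee0_abs// lee_fin.
move=> /(_ erefl); apply: filterS => v /(_ I) /= [] /eqP sv.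
apply/rowP => j; apply/eqP; rewrite -subr_eq0 -sqrf_eq0.
by move: sv; rewrite psumr_eq0 => [/allP/(_ j)|i _]; [apply; exact: mem_index_enum|exact: sqr_ge0].
Qed.

End optimality.
End principal_components.

Theorem theorem3p14 (R : realType) (n p : nat) (U : set 'rV[R]_n)
    (dU : compact_domain U)
    (X : completeNormedModType R) (sX : separable_space X)
    (mu : probability (borel X) R) (G : {mfun borel X >-> borel (L2 dU)})
    (G2 : (\int[mu]_u (`|G u : L2 dU| ^+ 2)%:E < +oo)%E)
    (lam : nat -> R) (tau : 'I_p -> L2 dU) :
  let nu := distribution mu G in
  let tau0 := l2mean nu in
  let Gamma := covariance_op nu in
  ordered_spectrum Gamma lam ->
  l2orthonormal tau ->
  (forall j, Gamma (tau j) = lam j *: tau j) ->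
  let Ropt := affine_reconstruction tau0 tau in
  let Popt := affine_projection tau0 tau in
  [/\ measurable_projection Popt /\ affine_map Popt,
      forall (sigma0 : L2 dU) (sigma : 'I_p -> L2 dU) (P : L2 dU -> 'rV[R]_p),
        measurable_projection P ->
        (reconstruction_error nu Ropt Popt
         <= reconstruction_error nu (affine_reconstruction sigma0 sigma) P)%E,
      (sqrte (\sum_(p <= k <oo) (lam k)%:E) <= reconstruction_error nu Ropt Popt)%E,
      forall P : L2 dU -> 'rV[R]_p, measurable_projection P ->
        (reconstruction_error nu Ropt Popt <= reconstruction_error nu Ropt P)%E &
      forall P : L2 dU -> 'rV[R]_p, measurable_projection P ->
        reconstruction_error nu Ropt P = reconstruction_error nu Ropt Popt ->
        {ae nu, forall v, P v = Popt v}].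
Proof.
move=> nu tau0 Gamma specG otau Gtau Ropt Popt.
(* Change of variables carries [G2] over to the push-forward. *)
have nu2 : (\int[nu]_v (`|v : L2 dU| ^+ 2)%:E < +oo)%E.
  rewrite ge0_integral_pushforward//.
  apply/measurable_EFinP; apply: continuous_measurable_borel.
  exact: norm_sqr_continuous.
split.
- split; last exact: affine_projection_affine.
  by apply: continuous_borel_measurable; exact: affine_projection_continuous.
- by move=> sigma0 sigma P _; exact: (optimal_error_le nu2 specG otau Gtau).
- exact: (optimal_error_ge nu2 specG otau Gtau).
- by move=> P _; exact: (optimal_error_le nu2 specG otau Gtau).
- by move=> P; exact: (optimal_projection_unique nu2 otau Gtau).
Qed.
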